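(* Let $n\ge 1$ and let $F=F(\boldsymbol{x})$ be a homogeneous symmetric function of degree $n$ over $\mathbb{Q}(q,t)$. Then $$\langle p_n,\nabla_\ast\rangle F=\Pi F,$$ and, for every $0\le k\le n$, $$\langle e_kh_{n-k},\nabla_\ast\rangle F=\Delta_{e_k}F .$$
   Context: $\Lambda$ is the ring of symmetric functions in $\boldsymbol{x}=(x_1,x_2,\dots)$ over $\mathbb{Q}(q,t)$, $\langle\cdot,\cdot\rangle$ is the Hall scalar product, and $F[\cdot]$ denotes plethysm. A partition $\mu$ is identified with its (French) Ferrers diagram, i.e. the set of cells $(i,j)$ with $0\le j<\ell(\mu)$ and $0\le i<\mu_{j+1}$. $\widetilde{H}_\mu=\widetilde{H}_\mu(\boldsymbol{x};q,t)$ denotes the modified Macdonald polynomials (a basis of $\Lambda$), with the convention characterized by: $\widetilde H_\mu[\boldsymbol{x}(1-q)]\in\mathrm{span}\{s_\lambda:\lambda\ge\mu\}$, $\widetilde H_\mu[\boldsymbol{x}(1-t)]\in\mathrm{span}\{s_\lambda:\lambda\ge\mu'\}$ (dominance order), $\langle \widetilde H_\mu,s_{(n)}\rangle=1$. For instance $\widetilde H_{(3)}=s_3+(q+q^2)s_{21}+q^3s_{111}$. The operator $\nabla_\ast:\Lambda\to\Lambda\otimes\Lambda$ is the linear map with $\nabla_\ast\widetilde H_\mu=\widetilde H_\mu\otimes\widetilde H_\mu$. For a symmetric function $G$, $\langle G,\nabla_\ast\rangle:\Lambda\to\Lambda$ denotes the linear operator defined by $\langle G,\nabla_\ast\rangle\widetilde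 H_\mu=\langle G,\widetilde H_\mu\rangle\,\widetilde H_\mu$. Put $B_\mu=\sum_{(i,j)\in\mu}q^it^j$. The operators $\Delta_G$ (for $G\in\Lambda$) and $\Pi$ are the linear operators with $\Delta_G\widetilde H_\mu=G[B_\mu]\,\widetilde H_\mu$ and $\Pi\widetilde H_\mu=\Big(\prod_{(i,j)\in\mu,\ (i,j)\ne(0,0)}(1-q^it^j)\Big)\widetilde H_\mu$. *)

(* Defs.v *)
From HB Require Import structures.
From mathcomp Require Import all_boot all_order all_fingroup all_algebra.
From mathcomp Require Import fraction finmap mpoly boolp classical_sets.

Set Implicit Arguments.
Unset Strict Implicit.
Unset Printing Implicit Defensive.

Import GRing.Theory.
Local Open Scope ring_scope.

(** * The field Q(q,t) *)

Definition Qqt : fieldType := {fraction {mpoly rat[2]}}.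
Definition q : Qqt := tofrac 'X_(@ord0 1).
Definition t : Qqt := tofrac 'X_(@ord_max 1).

(** * The ring of symmetric functions

    As in Macdonald's book, the ring of symmetric functions is the inverse
    limit, in the category of graded rings, of the rings of symmetric
    polynomials in x_1, ..., x_N: an element is a sequence (f_N) of symmetric
    polynomials of bounded degree, f_N in the variables x_1, ..., x_N, with
    f_(N+1)(x_1, ..., x_N, 0) = f_N. *)

Definition kill_last N (f : {mpoly Qqt[N.+1]}) : {mpoly Qqt[N]} :=
  f \mPo [tuple if unlift ord_max i is Some j then 'X_j else 0 | i < N.+1].

Definition is_symfun (f : forall N, {mpoly Qqt[N]}) : Prop :=
  [/\ forall N, f N \is symmetric,
      forall N, kill_last (f N.+1) = f N
    & exists d, forall N, (msize (f N) <= d)%N].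

Record symfun := SymFun {
  sfpoly :> forall N, {mpoly Qqt[N]};
  sfpolyP : is_symfun sfpoly }.

HB.instance Definition _ := gen_eqMixin symfun.
HB.instance Definition _ := gen_choiceMixin symfun.

Lemma symfunP (f g : symfun) : (forall N, f N = g N) -> f = g.
Proof.
case: f g => [f Pf] [g Pg] /= efg.
have e : f = g by apply: functional_extensionality_dep.
by case: _ / e Pg => Pg; congr SymFun; apply: Prop_irrelevance.
Qed.

Lemma is_symfun0 : is_symfun (fun N => 0).
Proof.
split=> [N|N|]; first exact: rpred0.
  by rewrite /kill_last raddf0.
by exists 0%N => N; rewrite msize0.
Qed.

Lemma is_symfun1 : is_symfun (fun N => 1).
Proof.
split=> [N|N|]; first exact: rpred1.
  by rewrite /kill_last rmorph1.
by exists 1%N => N; rewrite msize1.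
Qed.

Lemma is_symfunD (f g : symfun) : is_symfun (fun N => f N + g N).
Proof.
case: f g => [f [sf kf [df bf]]] [g [sg kg [dg bg]]] /=.
split=> [N|N|]; first by rewrite rpredD ?sf ?sg.
  by rewrite /kill_last raddfD; congr (_ + _); [apply: kf|apply: kg].
exists (maxn df dg) => N; apply: leq_trans (mmeasureD_le _ _ _) _.
by rewrite geq_max !leq_max bf bg orbT.
Qed.

Lemma is_symfunN (f : symfun) : is_symfun (fun N => - f N).
Proof.
case: f => [f [sf kf [df bf]]] /=.
split=> [N|N|]; first by rewrite rpredN ?sf.
  by rewrite /kill_last raddfN; congr (- _); apply: kf.
by exists df => N; rewrite mmeasureN.
Qed.

Lemma is_symfunM (f g : symfun) : is_symfun (fun N => f N * g N).
Proof.
case: f g => [f [sf kf [df bf]]] [g [sg kg [dg bg]]] /=.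
split=> [N|N|]; first by rewrite rpredM ?sf ?sg.
  by rewrite /kill_last rmorphM; congr (_ * _); [apply: kf|apply: kg].
exists (df + dg).+1 => N; apply: leq_trans (msizeM_le _ _) _.
by rewrite ltnS leq_add.
Qed.

Lemma is_symfunZ (c : Qqt) (f : symfun) : is_symfun (fun N => c *: f N).
Proof.
case: f => [f [sf kf [df bf]]] /=.
split=> [N|N|]; first by rewrite rpredZ ?sf.
  by rewrite /kill_last comp_mpolyZ; congr (_ *: _); apply: kf.
by exists df => N; apply: leq_trans (msizeZ_le _ _) (bf N).
Qed.

Definition sf0 := SymFun is_symfun0.
Definition sf1 := SymFun is_symfun1.
Definition sfadd (f g : symfun) := SymFun (is_symfunD f g).
Definition sfopp (f : symfun) := SymFun (is_symfunN f).
Definition sfmul (f g : symfun) := SymFun (is_symfunM f g).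
Definition sfscale (c : Qqt) (f : symfun) := SymFun (is_symfunZ c f).

Lemma sfaddA : associative sfadd.
Proof. by move=> f g h; apply: symfunP => N /=; rewrite addrA. Qed.
Lemma sfaddC : commutative sfadd.
Proof. by move=> f g; apply: symfunP => N /=; rewrite addrC. Qed.
Lemma sfadd0 : left_id sf0 sfadd.
Proof. by move=> f; apply: symfunP => N /=; rewrite add0r. Qed.
Lemma sfaddN : left_inverse sf0 sfopp sfadd.
Proof. by move=> f; apply: symfunP => N /=; rewrite addNr. Qed.

HB.instance Definition _ :=
  GRing.isZmodule.Build symfun sfaddA sfaddC sfadd0 sfaddN.

Lemma sfmulA : associative sfmul.
Proof. by move=> f g h; apply: symfunP => N /=; rewrite mulrA. Qed.
Lemma sfmulC : commutative sfmul.
Proof. by move=> f g; apply: symfunP => N /=; rewrite mulrC. Qed.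
Lemma sfmul1 : left_id sf1 sfmul.
Proof. by move=> f; apply: symfunP => N /=; rewrite mul1r. Qed.
Lemma sfmulD : left_distributive sfmul sfadd.
Proof. by move=> f g h; apply: symfunP => N /=; rewrite mulrDl. Qed.
Lemma sf1_neq0 : sf1 != sf0.
Proof.
apply/eqP => /(congr1 (fun f : symfun => f 0%N)) /= /eqP.
by rewrite oner_eq0.
Qed.

HB.instance Definition _ :=
  GRing.Zmodule_isComNzRing.Build symfun sfmulA sfmulC sfmul1 sfmulD sf1_neq0.

Lemma sfscaleA a b f : sfscale a (sfscale b f) = sfscale (a * b) f.
Proof. by apply: symfunP => N /=; rewrite scalerA. Qed.
Lemma sfscale1 : left_id 1 sfscale.
Proof. by move=> f; apply: symfunP => N /=; rewrite scale1r. Qed.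
Lemma sfscaleDr : right_distributive sfscale +%R.
Proof. by move=> a f g; apply: symfunP => N /=; rewrite scalerDr. Qed.
Lemma sfscaleDl f : {morph sfscale^~ f : a b / a + b}.
Proof. by move=> a b; apply: symfunP => N /=; rewrite scalerDl. Qed.

HB.instance Definition _ :=
  GRing.Zmodule_isLmodule.Build Qqt symfun
    sfscaleA sfscale1 sfscaleDr sfscaleDl.

Lemma sfscaleAl (a : Qqt) (f g : symfun) : a *: (f * g) = a *: f * g.
Proof. by apply: symfunP => N /=; rewrite scalerAl. Qed.

HB.instance Definition _ :=
  GRing.Lmodule_isLalgebra.Build Qqt symfun sfscaleAl.

Lemma sfscaleAr (a : Qqt) (f g : symfun) : a *: (f * g) = f * (a *: g).
Proof. by apply: symfunP => N /=; rewrite scalerAr. Qed.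

HB.instance Definition _ :=
  GRing.Lalgebra_isAlgebra.Build Qqt symfun sfscaleAr.

Definition homogeneous (n : nat) (F : symfun) : Prop :=
  forall N, F N \is n.-homog.

(** * Power sums, elementary, complete and Schur functions *)

Lemma mcoeff_kill_last N (f : {mpoly Qqt[N.+1]}) (m : 'X_{1..N}) :
  (kill_last f)@_m = f@_(mnmwiden m).
Proof.
have killX (m' : 'X_{1..N.+1}) :
    kill_last 'X_[m'] = ('X_[[multinom m' (lift ord_max i) | i < N]]
                          *+ (m' ord_max == 0%N))%R.
  rewrite /kill_last comp_mpolyX big_ord_recr /= tnth_mktuple unlift_none.
  rewrite expr0n -[RHS]mulr_natr; congr (_ * _).
  rewrite [in RHS]mpolyXE_id; apply: eq_bigr => i _.
  rewrite tnth_mktuple mnmE; have -> : widen_ord (leqnSn N) i = lift ord_max i.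
    by apply: val_inj; rewrite /= /bump leqNgt ltn_ord.
  by rewrite liftK.
rewrite {1}[f]mpolyE [in RHS](mpolyE f) /kill_last.
rewrite (raddf_sum (comp_mpoly _)) !(raddf_sum (mcoeff _)) /=.
apply: eq_bigr => m' _.
rewrite comp_mpolyZ !mcoeffZ -/(kill_last 'X_[m']) killX mcoeffMn !mcoeffX.
congr (_ * _); rewrite -mulrnA mulnb; congr (_%:R).
congr (nat_of_bool _); apply/andP/eqP => [[/eqP <- /eqP m0]|->]; last first.
  split; last by rewrite mnmwiden_ordmax.
  apply/eqP/mnmP => i; rewrite mnmE.
  have -> : lift ord_max i = widen_ord (leqnSn N) i.
    by apply: val_inj; rewrite /= /bump leqNgt ltn_ord.
  by rewrite mnmwiden_widen.
apply/mnmP => i; case: (unliftP ord_max i) => [j|] -> {i}; last first.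
  by rewrite mnmwiden_ordmax.
have -> : lift ord_max j = widen_ord (leqnSn N) j.
  by apply: val_inj; rewrite /= /bump leqNgt ltn_ord.
rewrite mnmwiden_widen mnmE; congr (m' _).
by apply: val_inj; rewrite /= /bump leqNgt ltn_ord.
Qed.

Lemma mdeg_mnmwiden N (m : 'X_{1..N}) : mdeg (mnmwiden m) = mdeg m.
Proof.
rewrite !mdegE big_ord_recr /= mnmwiden_ordmax addn0.
by apply: eq_bigr => i _; rewrite mnmwiden_widen.
Qed.

Lemma msize_leP N (f : {mpoly Qqt[N]}) d :
  (forall m, f@_m != 0 -> (mdeg m < d)%N) -> (msize f <= d)%N.
Proof.
move=> H; rewrite msizeE; apply/bigmax_leqP_seq => m + _.
by rewrite mcoeff_msupp => /H.
Qed.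

Definition psum_poly (k N : nat) : {mpoly Qqt[N]} :=
  if k == 0%N then 0 else \sum_(i < N) 'X_i ^+ k.

Lemma is_symfun_psum k : is_symfun (psum_poly k).
Proof.
rewrite /psum_poly; case: k => [|k]; first exact: is_symfun0.
split=> [N|N|] /=.
- apply/issymP => s; rewrite raddf_sum /= [RHS](reindex_inj (@perm_inj _ s)).
  apply: eq_bigr => i _; rewrite rmorphXn /= msymX; congr ('X_[_] ^+ _).
  by apply/mnmP => j; rewrite mnmE !mnm1E (canF_eq (permK s)).
- have -> : kill_last (\sum_(i < N.+1) 'X_i ^+ k.+1) =
      \sum_(i < N.+1) kill_last ('X_i ^+ k.+1) by exact: raddf_sum.
  have kX (i : 'I_N.+1) : kill_last ('X_i ^+ k.+1) =
      (if unlift ord_max i is Some j then 'X_j else 0 : {mpoly Qqt[N]}) ^+ k.+1.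
    rewrite /kill_last rmorphXn; congr (_ ^+ _).
    by rewrite [LHS]comp_mpolyXU -tnth_nth tnth_mktuple.
  rewrite big_ord_recr -[RHS]addr0; congr (_ + _); last first.
    by rewrite [LHS]kX unlift_none expr0n.
  apply: eq_bigr => i _; rewrite [LHS]kX.
  have -> : widen_ord (leqnSn N) i = lift ord_max i.
    by apply: val_inj; rewrite /= /bump leqNgt ltn_ord.
  by rewrite liftK.
exists k.+2 => N; apply: msize_leP => m; rewrite raddf_sum /=.
apply: contraNT; rewrite -leqNgt => lt_km; rewrite big1 // => i _.
rewrite mpolyXn mcoeffX; case: eqP => // em; move: lt_km.
by rewrite -em mdegMn mdeg1 mul1n ltnn.
Qed.

Lemma is_symfun_elem k : is_symfun (fun N => mesym N Qqt k).
Proof.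
split=> [N|N|]; first exact: mesym_sym.
  apply/mpolyP => m; rewrite mcoeff_kill_last !mcoeff_mesym; congr (_%:R).
  rewrite /mechar mdeg_mnmwiden; congr (nat_of_bool (_ && _)).
  apply/forallP/forallP => h i; first by rewrite -mnmwiden_widen.
  case: (unliftP ord_max i) => [j|] ->; last by rewrite mnmwiden_ordmax.
  have -> : lift ord_max j = widen_ord (leqnSn N) j.
    by apply: val_inj; rewrite /= /bump leqNgt ltn_ord.
  by rewrite mnmwiden_widen.
exists k.+1 => N; apply: msize_leP => m; rewrite mcoeff_mesym /mechar.
by case: (mdeg m =P k) => [->|] //=; rewrite eqxx.
Qed.

Definition complete_poly (k N : nat) : {mpoly Qqt[N]} :=
  \sum_(m : 'X_{1..N < k.+1} | mdeg m == k) 'X_[m].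

Lemma mcoeff_complete k N (m : 'X_{1..N}) :
  (complete_poly k N)@_m = (mdeg m == k)%:R.
Proof.
rewrite /complete_poly raddf_sum /=; have [em|ne] := eqVneq (mdeg m) k.
  have lt : (mdeg m < k.+1)%N by rewrite em.
  rewrite (bigD1 (BMultinom lt)) ?em //= mcoeffX eqxx big1 ?addr0 // => m'.
  by case/andP=> _ /eqP ne; rewrite mcoeffX; case: eqP => // e; case: ne; apply: val_inj.
rewrite big1 // => m' /eqP em'; rewrite mcoeffX; case: eqP => // e.
by rewrite -e em' eqxx in ne.
Qed.

Lemma is_symfun_complete k : is_symfun (complete_poly k).
Proof.
split=> [N|N|].
- apply/issymP => s; apply/mpolyP => m.
  by rewrite mcoeff_sym !mcoeff_complete mdeg_mperm.
- apply/mpolyP => m.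
  by rewrite mcoeff_kill_last !mcoeff_complete mdeg_mnmwiden.
exists k.+1 => N; apply: msize_leP => m; rewrite mcoeff_complete.
by case: (mdeg m =P k) => [->|] //=; rewrite eqxx.
Qed.

(* p_0 is never used; it is set to 0. *)
Definition psum (k : nat) : symfun := SymFun (is_symfun_psum k).
Definition elem (k : nat) : symfun := SymFun (is_symfun_elem k).
Definition complete (k : nat) : symfun := SymFun (is_symfun_complete k).

(** Jacobi-Trudi: s_la = det (h_(la_i - i + j)), with h_r = 0 for r < 0. *)
Definition schur (la : seq nat) : symfun :=
  \det (\matrix_(i < size la, j < size la)
          if (i <= nth 0 la i + j)%N then complete (nth 0 la i + j - i)
          else 0).

(** * Partitions *)

Definition is_part (la : seq nat) : bool :=
  sorted geq la && (0%N \notin la).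

Record part := Part { part_val :> seq nat; part_valP : is_part part_val }.

HB.instance Definition _ := [isSub for part_val].
HB.instance Definition _ := [Choice of part by <:].

Definition dominates (la mu : seq nat) : Prop :=
  sumn la = sumn mu /\ forall k, (sumn (take k mu) <= sumn (take k la))%N.

Definition conj_part (mu : seq nat) : seq nat :=
  [seq count (fun r => i < r)%N mu | i <- iota 0 (head 0%N mu)].

(* The cell (i, j) is in column i and in row j (French convention). *)
Definition cells (mu : seq nat) : seq (nat * nat) :=
  [seq (i, j) | j <- iota 0 (size mu), i <- iota 0 (nth 0%N mu j)].

(** * Bases of the ring of symmetric functions *)

Definition lincomb (V : lmodType Qqt) (b : part -> V)
    (c : {fsfun part -> Qqt with 0}) : V :=
  \sum_(la <- finsupp c) c la *: b la.

Definition is_basis (b : part -> symfun) : Prop :=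
  forall F : symfun, exists! c, F = lincomb b c.

(** The coordinates of F in b, and the linear map with b_la |-> g_la, are
    meaningful when b is a basis. *)
Definition coords (b : part -> symfun) (F : symfun) :
    {fsfun part -> Qqt with 0} :=
  xget [fsfun] [set c | F = lincomb b c]%classic.

Definition linext (b : part -> symfun) (V : lmodType Qqt) (g : part -> V)
    (F : symfun) : V :=
  lincomb g (coords b F).

(** * Hall scalar product and plethysm *)

Definition psum_part (la : part) : symfun := \prod_(k <- la) psum k.

Definition zee (la : seq nat) : nat :=
  \prod_(i <- undup la) (i ^ count_mem i la * (count_mem i la)`!).

(** <p_la, p_mu> = z_la if la = mu, and 0 otherwise. *)
Definition hall (F G : symfun) : Qqt :=
  \sum_(la <- finsupp (coords psum_part F))
    coords psum_part F la * coords psum_part G la * (zee la)%:R.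

(** The plethysm F |-> F[A], where [a k] is p_k[A], i.e. the expression A in
    which q, t and the variables x_i are replaced by their k-th powers: the
    algebra morphism with p_k |-> p_k[A]. *)
Definition plethysm (R : comAlgType Qqt) (a : nat -> R) : symfun -> R :=
  linext psum_part (fun la => \prod_(k <- la) a k).

(** F[x(1-u)] for u = q or u = t. *)
Definition pleth_x1m (u : Qqt) : symfun -> symfun :=
  plethysm (fun k => (1 - u ^+ k) *: psum k).

(** G[B_mu] with B_mu the sum of q^i t^j over the cells (i, j) of mu. *)
Definition pleth_B (mu : seq nat) : symfun -> Qqt :=
  plethysm (R := Qqt^o)
    (fun k => \sum_(c <- cells mu) (q ^+ c.1 * t ^+ c.2) ^+ k).

(** * Modified Macdonald polynomials and their eigenoperators *)

Definition in_schur_span (P : part -> Prop) (F : symfun) : Prop :=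
  exists2 c : {fsfun part -> Qqt with 0},
    (forall la, la \in finsupp c -> P la) & F = lincomb schur c.

Record is_modified_macdonald (H : part -> symfun) : Prop := {
  mac_basis : is_basis H;
  mac_q : forall mu : part,
    in_schur_span (fun la => dominates la mu) (pleth_x1m q (H mu));
  mac_t : forall mu : part,
    in_schur_span (fun la => dominates la (conj_part mu))
      (pleth_x1m t (H mu));
  mac_1 : forall mu : part, hall (H mu) (schur [:: sumn mu]) = 1 }.

(** The operator <G, nabla_*>. *)
Definition nabla_star (H : part -> symfun) (G : symfun) : symfun -> symfun :=
  linext H (fun mu => hall G (H mu) *: H mu).

Definition Delta (H : part -> symfun) (G : symfun) : symfun -> symfun :=
  linext H (fun mu => pleth_B mu G *: H mu).

Definition PiOp (H : part -> symfun) : symfun -> symfun :=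
  linext H (fun mu =>
    (\prod_(c <- cells mu | c != (0%N, 0%N)) (1 - q ^+ c.1 * t ^+ c.2))
      *: H mu).

(* Main.v *)
(** The polynomial [H_mu[1-u]] has degree [n = |mu|] in [u] and value 1 at
    [u = 0].  It vanishes at [u = q^-a t^-b] for every cell [(a,b)] of [mu], so
    it is the product of the factors [1 - u q^i t^j] over the cells.  Its
    coefficients are [(-1)^k <e_k h_(n-k), H_mu>], and minus its derivative at
    [u = 1] is [<p_n, H_mu>].

    The vanishing comes from the Macdonald operator
    [D_0 F = F[X + (1-q)(1-t)/z] sum_i (-z)^i e_i] (coefficient of [z^0]).  The
    coefficients of [F[-(1-q)(y_1+...+y_a) - (1-t)(z_1+...+z_b)]] at monomials in
    [y, z] are linear functionals on which [D_0] acts triangularly, with diagonal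
    entries [1 - (1-q)(1-t) B], [B] being the sum of the weights of a set of
    cells avoiding [(a,b)].  An eigenvector with eigenvalue
    [1 - (1-q)(1-t) B_mu], [(a,b)] in [mu], is therefore killed by all these
    functionals, and specializing [y_i = q^-i], [z_j = q^-a t^-j] turns the
    alphabet into [1 - q^-a t^-b].

    That [H_mu] is such an eigenvector follows from the same triangularity with
    only [y]'s and with only [z]'s.  The two span conditions say that functionals
    indexed by exponents not dominated by [mu'] (resp. [mu]) vanish on [H_mu],
    so [H_mu] is annihilated by a product of factors [D_0 - c] in two ways, and
    the only common [c] is the one attached to [mu]. *)

Require Import Defs.
From HB Require Import structures.
From mathcomp Require Import all_boot all_order all_fingroup all_algebra.
From mathcomp Require Import fraction finmap mpoly boolp classical_sets.
From mathcomp Require Import ring zify.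

Set Implicit Arguments.
Unset Strict Implicit.
Unset Printing Implicit Defensive.

Import GRing.Theory.
Local Open Scope ring_scope.

(** * Linear combinations and bases *)

(** The characterization of H_mu names no operator, so the eigenvector property has to be extracted
    from two triangularities. One alone leaves many candidate eigenvalues; two suffice because
    conjugation reverses dominance: a diagram whose columns are dominated by the conjugate of mu has
    rows that dominate mu. A common diagonal entry does give one diagram, since the monomials q^i
    t^j are linearly independent and B determines its cells. Dominance is a partial order and
    different words may share a diagonal entry, whence annihilating products instead of an
    eigenbasis. The triangularity rests on (1-q)(1-t) = (1-u)(1-v) for {u, v} = {q, t}: at z = 1/y
    the shifts by -(1-u) y and by (1-u)(1-v)/z merge into the shift by -(1-u) v y, of the same kind
    as the first. This produces the powers of v in the diagonal entries. The products e_k h_(n-k)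
    enter through h_n[X(1-u)], whose Hall product with F is F[1-u]. *)

Notation coeffs := {fsfun part -> Qqt with 0}.

Lemma lincombE (V : lmodType Qqt) (b : part -> V) (c : coeffs) (S : {fset part}) :
  (finsupp c `<=` S)%fset -> lincomb b c = \sum_(la <- S) c la *: b la.
Proof.
move=> sub; rewrite /lincomb; apply: big_fset_incl => // la _ h.
by rewrite (fsfun_dflt h) scale0r.
Qed.

Lemma lincomb_fsfun (V : lmodType Qqt) (b : part -> V) (S : {fset part})
    (f : part -> Qqt) :
  lincomb b [fsfun la in S => f la | 0] = \sum_(la <- S) f la *: b la.
Proof.
rewrite (@lincombE _ _ _ S) ?finsupp_sub //.
by rewrite big_seq [RHS]big_seq; apply: eq_bigr => la hla; rewrite fsfunE hla.
Qed.

Definition addc (a : Qqt) (c d : coeffs) : coeffs :=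
  [fsfun la in (finsupp c `|` finsupp d)%fset => a * c la + d la | 0].

Lemma addcE a c d la : addc a c d la = a * c la + d la.
Proof.
rewrite fsfunE inE; case: finsuppP => //= h; case: finsuppP => // h'.
by rewrite mulr0 addr0.
Qed.

Lemma lincomb_addc (V : lmodType Qqt) (b : part -> V) a c d :
  lincomb b (addc a c d) = a *: lincomb b c + lincomb b d.
Proof.
rewrite lincomb_fsfun (@lincombE _ b c (finsupp c `|` finsupp d)%fset) ?fsubsetUl //.
rewrite (@lincombE _ b d (finsupp c `|` finsupp d)%fset) ?fsubsetUr //.
rewrite scaler_sumr -big_split /=; apply: eq_bigr => la _.
by rewrite scalerDl scalerA.
Qed.

Definition deltac (la : part) : coeffs := [fsfun la' in [fset la]%fset => 1 | 0].

Lemma deltacE la la' : deltac la la' = (la' == la)%:R.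
Proof. by rewrite fsfunE !inE; case: eqP. Qed.

Lemma lincomb_deltac (V : lmodType Qqt) (b : part -> V) la :
  lincomb b (deltac la) = b la.
Proof. by rewrite lincomb_fsfun big_seq_fset1 scale1r. Qed.

Lemma lincomb0 (V : lmodType Qqt) (b : part -> V) :
  lincomb b ([fsfun] : coeffs) = 0.
Proof. by rewrite /lincomb finsupp0 big_seq_fset0. Qed.

Definition inspan (V : lmodType Qqt) (b : part -> V) (F : V) :=
  exists c, F = lincomb b c.

Lemma inspan0 (V : lmodType Qqt) (b : part -> V) : inspan b 0.
Proof. by exists [fsfun]; rewrite lincomb0. Qed.

Lemma inspanD (V : lmodType Qqt) (b : part -> V) F G :
  inspan b F -> inspan b G -> inspan b (F + G).
Proof. by move=> [c ->] [d ->]; exists (addc 1 c d); rewrite lincomb_addc scale1r. Qed.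

Lemma inspanZ (V : lmodType Qqt) (b : part -> V) a F :
  inspan b F -> inspan b (a *: F).
Proof.
by move=> [c ->]; exists (addc a c [fsfun]); rewrite lincomb_addc lincomb0 addr0.
Qed.

Lemma inspan_base (V : lmodType Qqt) (b : part -> V) la : inspan b (b la).
Proof. by exists (deltac la); rewrite lincomb_deltac. Qed.

Lemma inspan_sum (V : lmodType Qqt) (b : part -> V) (I : Type) (s : seq I)
    (P : pred I) (f : I -> V) :
  (forall i, P i -> inspan b (f i)) -> inspan b (\sum_(i <- s | P i) f i).
Proof.
by move=> h; elim/big_rec: _ => [|i x Pi]; [exact: inspan0|apply: inspanD; exact: h].
Qed.

Lemma is_basisI (b : part -> symfun) :
  (forall F, inspan b F) -> (forall c, lincomb b c = 0 -> c = [fsfun]) ->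
  is_basis b.
Proof.
move=> sp fr F; have [c Fc] := sp F; exists c; split=> // d Fd.
have /fr : lincomb b (addc (-1) d c) = 0.
  by rewrite lincomb_addc -Fd -Fc scaleN1r addNr.
move/fsfunP => h; apply/fsfunP => la; have := h la.
by rewrite addcE fsfun0E mulN1r addrC => /eqP; rewrite subr_eq0 => /eqP.
Qed.

Section Coords.
Variables (b : part -> symfun) (bb : is_basis b).

Lemma coordsP F : F = lincomb b (coords b F).
Proof.
rewrite /coords; case: xgetP => [c -> //|/(_ _) no].
by have [c [Fc _]] := bb F; case: (no c).
Qed.

Lemma coords_lincomb c : coords b (lincomb b c) = c.
Proof.
have [d [_ u]] := bb (lincomb b c).
by rewrite -[RHS]u //; apply/esym/u; exact: coordsP.
Qed.

Lemma coords_linear a F G la :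
  coords b (a *: F + G) la = a * coords b F la + coords b G la.
Proof.
by rewrite {1}[F]coordsP {1}[G]coordsP -lincomb_addc coords_lincomb addcE.
Qed.

Lemma coords_base la la' : coords b (b la) la' = (la' == la)%:R.
Proof. by rewrite -{1}[b la]lincomb_deltac coords_lincomb deltacE. Qed.

Lemma basis_ind (P : symfun -> Prop) :
  P 0 -> (forall a F G, P F -> P G -> P (a *: F + G)) ->
  (forall la, P (b la)) -> forall F, P F.
Proof.
move=> P0 PD Pb F; rewrite [F]coordsP /lincomb.
by elim/big_rec: _ => // la G _ PG; apply: PD.
Qed.

End Coords.

(** * Newton's identities *)

Definition torsion_free (R : nzRingType) :=
  forall (x : R) n, x *+ n.+1 = 0 -> x = 0.

(** Division-free form of sum x_n z^n = exp(- sum a_k z^k / k), namely z X' = - A X. For a_k =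
    p_k[A] the solution is x_n = (-1)^n e_n[A]; for a_k = - p_k[A] it is h_n[A]. *)
Definition newton (R : comNzRingType) (a x : nat -> R) :=
  x 0%N = 1 /\
  forall n, x n *+ n = - \sum_(1 <= k < n.+1) a k * x (n - k)%N.

Definition conv (R : comNzRingType) (x y : nat -> R) n :=
  \sum_(i < n.+1) x i * y (n - i)%N.

Lemma newton_unique (R : comNzRingType) (a x y : nat -> R) :
  torsion_free R -> newton a x -> newton a y -> x =1 y.
Proof.
move=> tf [x0 xS] [y0 yS] n; elim/ltn_ind: n => -[|n] IH; first by rewrite x0.
apply/eqP; rewrite -subr_eq0; apply/eqP/(tf _ n).
rewrite mulrnBl xS yS opprK addrC -sumrB big_nat big1 // => k /andP[k1 kn].
by rewrite IH ?subrr // ltn_subrL k1.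
Qed.

Lemma newton_poly (R : comNzRingType) (a x : nat -> R) N :
  newton a x ->
  let X := \poly_(i < N.+1) x i in
  let A := \poly_(i < N.+1) (a i *+ (0 < i)%N) in
  forall n, (n <= N)%N -> ('X * X^`() + A * X)`_n = 0.
Proof.
move=> [x0 xS] X A n nN; rewrite coefD coefXM coef_deriv.
have -> : (if n == 0%N then 0 else X`_n.-1.+1 *+ n.-1.+1) = x n *+ n.
  by case: n nN => //= n nN; rewrite coef_poly ltnS nN.
rewrite xS coefM big_ord_recl /= {1}/A coef_poly /= mulr0n mul0r add0r.
rewrite big_add1 /= big_mkord addrC; apply/eqP; rewrite subr_eq0; apply/eqP.
apply: eq_bigr => i _; rewrite !coef_poly /bump /= add1n ltnS.
by rewrite (leq_trans (ltn_ord i) nN) mulr1n ltnS (leq_trans (leq_subr _ _) nN).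
Qed.

Lemma coef_low_mul (R : comNzRingType) (p r : {poly R}) N :
  (forall n, (n <= N)%N -> p`_n = 0) -> forall n, (n <= N)%N -> (p * r)`_n = 0.
Proof.
move=> h n nN; rewrite coefM big1 // => i _; rewrite h ?mul0r //.
by rewrite (leq_trans _ nN) // -ltnS.
Qed.

(** Logarithmic derivatives turn products into sums: z (XY)' + (A + B) XY = (z X' + A X) Y + (z Y' +
    B Y) X. Truncation at degree n makes this an identity of polynomials. *)
Lemma newton_conv (R : comNzRingType) (a b x y : nat -> R) :
  newton a x -> newton b y -> newton (fun k => a k + b k) (conv x y).
Proof.
move=> nx ny; split; first by rewrite /conv big_ord1 nx.1 ny.1 mulr1.
move=> n; pose X := \poly_(i < n.+1) x i; pose Y := \poly_(i < n.+1) y i.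
pose A := \poly_(i < n.+1) (a i *+ (0 < i)%N).
pose B := \poly_(i < n.+1) (b i *+ (0 < i)%N).
have cXY m : (m <= n)%N -> (X * Y)`_m = conv x y m.
  move=> mn; rewrite coefM; apply: eq_bigr => i _.
  rewrite !coef_poly (leq_trans (ltn_ord i)) ?ltnS //.
  by rewrite (leq_trans (leq_subr _ _) mn).
have : ('X * (X * Y)^`() + (A + B) * (X * Y))`_n = 0.
  have -> : 'X * (X * Y)^`() + (A + B) * (X * Y) =
      ('X * X^`() + A * X) * Y + ('X * Y^`() + B * Y) * X.
    rewrite derivM !mulrDl !mulrDr !mulrA -!addrA; congr (_ + _).
    rewrite [RHS]addrCA; congr (_ + _); first by rewrite mulrAC.
    by congr (_ + _); rewrite mulrAC.
  rewrite coefD !(@coef_low_mul _ _ _ n) ?addr0 //; exact: newton_poly.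
rewrite coefD coefXM coef_deriv.
have -> : (if n == 0%N then 0 else (X * Y)`_n.-1.+1 *+ n.-1.+1) = conv x y n *+ n.
  by case: n @X @Y @A @B cXY => [|n] X Y A B h; rewrite ?mulr0n // h.
move/eqP; rewrite addr_eq0 => /eqP ->; congr (- _).
rewrite coefM big_ord_recl coefD !coef_poly /= !mulr0n addr0 mul0r add0r.
rewrite big_add1 big_mkord; apply: eq_bigr => i _.
rewrite coefD !coef_poly /bump /= add1n ltnS ltn_ord !mulr1n cXY //.
by rewrite leq_subr.
Qed.

Lemma newton_map (R S : comNzRingType) (f : {rmorphism R -> S}) (a x : nat -> R) :
  newton a x -> newton (fun k => f (a k)) (fun n => f (x n)).
Proof.
move=> [x0 xS]; split=> [|n]; first by rewrite x0 rmorph1.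
rewrite -rmorphMn xS rmorphN rmorph_sum; congr (- _).
by apply: eq_bigr => k _; rewrite rmorphM.
Qed.

Lemma eq_newton (R : comNzRingType) (a b x y : nat -> R) :
  (forall k, (0 < k)%N -> a k = b k) -> x =1 y -> newton a x -> newton b y.
Proof.
move=> ab xy [x0 xS]; split=> [|n]; first by rewrite -xy.
rewrite -xy xS; congr (- _); apply: eq_big_nat => k /andP[k0 _].
by rewrite ab // xy.
Qed.

Lemma newton_geom (R : comNzRingType) (y : R) :
  newton (fun k => - y ^+ k) (fun n => y ^+ n).
Proof.
split=> [|n]; first by rewrite expr0.
under eq_big_nat => k /andP[_ kn].
  by rewrite mulNr -exprD subnKC //; over.
by rewrite sumrN opprK big_const_nat iter_addr addr0 subn1.
Qed.

Lemma newton_lin (R : comNzRingType) (y : R) :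
  newton (fun k => y ^+ k) (fun n => if n is n'.+1 then - y *+ (n' == 0%N) else 1).
Proof.
split=> // -[|n]; first by rewrite big_geq // oppr0.
rewrite big_nat_recr //= subnn mulr1.
case: n => [|n].
  by rewrite big_geq // add0r expr1 !mulr1n.
rewrite mulr0n mul0rn big_nat_recr //= subSnn eqxx mulr1n mulrN.
rewrite -exprSr big_nat big1 ?add0r ?addNr ?oppr0 // => k /andP[k0 kn].
by rewrite (subSn (ltnW kn)) (@subSn k n) //= mulr0n mulr0.
Qed.

Lemma newton_sign (R : comNzRingType) (a x : nat -> R) (c : R) :
  newton a x -> newton (fun k => c ^+ k * a k) (fun n => c ^+ n * x n).
Proof.
move=> [x0 xS]; split=> [|n]; first by rewrite x0 expr0 mulr1.
rewrite -mulrnAr xS mulrN mulr_sumr; congr (- _).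
by apply: eq_big_nat => k /andP[_ kn]; rewrite mulrACA -exprD subnKC.
Qed.

Lemma nat_Qqt_eq0 n : (n%:R == 0 :> Qqt) = (n == 0%N).
Proof.
have -> : n%:R = tofrac (n%:R) :> Qqt by rewrite rmorph_nat.
rewrite tofrac_eq0 -mpolyC_nat mpolyC_eq0.
exact: Num.Theory.pnatr_eq0.
Qed.

Lemma torsion_free_lmod (R : lalgType Qqt) : torsion_free R.
Proof.
move=> x n; rewrite -scaler_nat => /(congr1 (fun y => (n.+1%:R)^-1 *: y)).
by rewrite scalerA mulVf ?nat_Qqt_eq0 // scale1r scaler0.
Qed.

Lemma torsion_free_poly (R : comNzRingType) :
  torsion_free R -> torsion_free {poly R}.
Proof.
move=> tf p n /polyP h; apply/polyP => i; rewrite coef0.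
by apply: (tf _ n); have := h i; rewrite coefMn coef0.
Qed.

Lemma torsion_free_Qqt : torsion_free Qqt.
Proof. exact: (@torsion_free_lmod Qqt^o). Qed.

Lemma torsion_free_symfun : torsion_free symfun.
Proof. exact: torsion_free_lmod. Qed.

(** With this sign, sum eps_n z^n is the product of the factors 1 - x_i z, the Newton series of the
    power sums themselves. *)
Definition eps n : symfun := (-1) ^+ n *: elem n.

Lemma psum_poly_S k N : (0 < k)%N ->
  psum_poly k N.+1 = mwiden (psum_poly k N) + 'X_ord_max ^+ k.
Proof.
case: k => // k _; rewrite /psum_poly /= big_ord_recr /=; congr (_ + _).
rewrite rmorph_sum /=; apply: eq_bigr => i _; rewrite rmorphXn /= mwidenX.
congr ('X_[_] ^+ _); apply/mnmP => j.
case: (unliftP ord_max j) => [j'|] ->.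
  have -> : lift ord_max j' = widen_ord (leqnSn N) j'.
    by apply: val_inj; rewrite /= /bump leqNgt ltn_ord.
  by rewrite mnmwiden_widen !mnm1E.
by rewrite mnmwiden_ordmax mnm1E; case: eqP => // /(congr1 val) /= h; have := ltn_ord i; rewrite h ltnn.
Qed.

Lemma conv_lin (R : comNzRingType) (x : nat -> R) (y : R) n :
  conv x (fun n => if n is n'.+1 then - y *+ (n' == 0%N) else 1) n =
  x n - (if n is n'.+1 then x n' * y else 0).
Proof.
rewrite /conv big_ord_recr /= subnn mulr1 addrC; congr (_ + _).
case: n => [|n]; first by rewrite big_ord0 oppr0.
rewrite big_ord_recr /= subSnn eqxx mulr1n mulrN big1 ?add0r //.
move=> i _; rewrite subSn 1?ltnW //= subn_eq0 leqNgt ltn_ord.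
by rewrite mulr0n mulr0.
Qed.

(** One more variable x multiplies the series by 1 - x z, which is [mesymSS]. *)
Lemma newton_mesym N :
  newton (fun k => psum_poly k N) (fun n => (-1) ^+ n *: mesym N Qqt n).
Proof.
elim: N => [|N IH].
  split=> [|n]; first by rewrite expr0 scale1r mesym0E.
  rewrite big1 ?oppr0; last first.
    by move=> k _; rewrite /psum_poly; case: ifP => _; rewrite ?big_ord0 mul0r.
  by case: n => [|n]; rewrite ?mulr0n // mesym_geqnE ?scaler0 ?mul0rn.
have h := newton_conv (newton_map (@mwiden N Qqt) IH) (newton_lin 'X_ord_max).
apply: eq_newton h => [k k0|n]; first by rewrite (psum_poly_S N k0) /=.
rewrite conv_lin; case: n => [|n].
  by rewrite subr0 !expr0 !scale1r !mesym0E; exact: rmorph1.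
rewrite mesymSS scalerDr; congr (_ + _); first exact: mwidenZ.
rewrite exprS mulN1r scaleNr; congr (- _); rewrite scalerAl; congr (_ * _); exact: mwidenZ.
Qed.

Definition sfproj N (f : symfun) : {mpoly Qqt[N]} := f N.
Arguments sfproj N f : simpl never.

Lemma sfproj_is_zmod_morphism N : zmod_morphism (sfproj N).
Proof. by []. Qed.
Lemma sfproj_is_monoid_morphism N : monoid_morphism (sfproj N).
Proof. by []. Qed.
HB.instance Definition _ N :=
  GRing.isZmodMorphism.Build symfun {mpoly Qqt[N]} (sfproj N)
    (sfproj_is_zmod_morphism N).
HB.instance Definition _ N :=
  GRing.isMonoidMorphism.Build symfun {mpoly Qqt[N]} (sfproj N)
    (sfproj_is_monoid_morphism N).

Lemma sfprojZ N a f : sfproj N (a *: f) = a *: sfproj N f.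
Proof. by []. Qed.

Lemma sfproj_eq (f g : symfun) : (forall N, sfproj N f = sfproj N g) -> f = g.
Proof. by move=> h; apply: symfunP. Qed.

Lemma newton_symfun (a x : nat -> symfun) :
  (forall N, newton (fun k => sfproj N (a k)) (fun n => sfproj N (x n))) ->
  newton a x.
Proof.
move=> h; split=> [|n]; apply: sfproj_eq => N; have [x0 xS] := h N.
  by rewrite x0 rmorph1.
by rewrite rmorphMn xS rmorphN rmorph_sum.
Qed.

Lemma newton_eps : newton psum eps.
Proof. by apply: newton_symfun => N; exact: newton_mesym. Qed.

Lemma mcoeff_XnM N i k (p : {mpoly Qqt[N]}) (m : 'X_{1..N}) :
  ('X_i ^+ k * p)@_m = if (k <= m i)%N then p@_(m - U_(i) *+ k) else 0.
Proof.
rewrite mpolyXn mulrC; case: leqP => h.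
  have {1}-> : m = (U_(i) *+ k + (m - U_(i) *+ k))%MM.
    rewrite addmC submK //; apply/mnm_lepP => j; rewrite mulmnE mnm1E.
    by case: eqP => [<-|]; rewrite ?mul1n ?mul0n.
  by rewrite mcoeffMX.
apply/eqP; rewrite mcoeff_eq0; apply/negP => /msuppM_le /allpairsP [[m1 m2] /= [_]].
rewrite msuppX mem_seq1 => /eqP -> em; move: h.
by rewrite em mnmDE mulmnE mnm1E eqxx mul1n ltnNge leq_addl.
Qed.

(** All coefficients of h_j in degree j are 1, so the coefficient of a monomial m of degree n in
    sum_k p_k h_(n-k) counts the pairs (i, k) with 1 <= k <= m_i; there are n of them. *)
Lemma newton_complete : newton (fun k => - psum k) complete.
Proof.
apply: newton_symfun => N; rewrite /sfproj /=; split.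
  by apply/mpolyP => m; rewrite mcoeff_complete mcoeff1 mdeg_eq0.
move=> n; apply/mpolyP => m; rewrite mcoeffMn mcoeff_complete.
under eq_bigr do rewrite mulNr; rewrite sumrN opprK raddf_sum /=.
under eq_big_nat => k /andP[k0 kn].
  rewrite /psum_poly gtn_eqF // mulr_suml raddf_sum /=.
  under eq_bigr do rewrite mcoeff_XnM mcoeff_complete.
  over.
have dec i k : (k <= m i)%N -> mdeg m = (k + mdeg (m - U_(i) *+ k)%MM)%N.
  move=> km; have /submK/(congr1 mdeg) <- : (U_(i) *+ k <= m)%MM.
    apply/mnm_lepP => j; rewrite mulmnE mnm1E.
    by case: eqP => [<-|]; rewrite ?mul1n ?mul0n.
  by rewrite mdegD mdegMn mdeg1 mul1n addnC.
rewrite exchange_big /=.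
have [e|ne] := eqVneq (mdeg m) n; last first.
  rewrite mul0rn big1 // => i _; rewrite big_nat big1 // => k /andP[k0 kn].
  case: leqP => // /dec e; case: eqP => // e'; case/eqP: ne.
  by rewrite e e' subnKC.
rewrite -{1}e mdegE -mulr_natl mulr1 natr_sum; apply: eq_bigr => i _.
have mi : (m i <= n)%N by rewrite -e mdegE (bigD1 i) //= leq_addr.
rewrite (big_cat_nat _ (n := (m i).+1)) //= [X in _ + X]big_nat [X in _ + X]big1.
  rewrite addr0 big_nat (eq_bigr (fun=> 1)) => [|k /andP[k0 km]].
    by rewrite -big_nat big_const_nat iter_addr addr0 subn1.
  rewrite ltnS in km; rewrite km; have /eqP := dec _ _ km.
  by rewrite e -{1}(subnKC (leq_trans km mi)) eqn_add2l eq_sym => ->.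
by move=> k /andP[km _]; rewrite leqNgt km.
Qed.

(** * Power sums form a basis *)

Lemma mkpart_proof (s : seq nat) : is_part (sort geq [seq k <- s | (0 < k)%N]).
Proof.
rewrite /is_part sort_sorted; last by move=> m n; exact: leq_total.
by rewrite mem_sort mem_filter.
Qed.

Definition mkpart (s : seq nat) : part := Part (mkpart_proof s).

Lemma sorted_geq_uniq (s1 s2 : seq nat) :
  sorted geq s1 -> sorted geq s2 -> perm_eq s1 s2 -> s1 = s2.
Proof.
apply: sorted_eq => [m n p h1 h2|m n]; first exact: leq_trans h2 h1.
by rewrite andbC -eqn_leq => /eqP.
Qed.

Lemma part_eqP (la mu : part) : perm_eq la mu -> la = mu.
Proof.
case: la mu => [la Pla] [mu Pmu] /= h; apply: val_inj => /=.
by case/andP: Pla Pmu => s1 _ /andP[s2 _]; exact: sorted_geq_uniq.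
Qed.

Lemma part_pos (la : part) k : k \in (la : seq nat) -> (0 < k)%N.
Proof. by case: la => la /= /andP[_]; case: k => // + h; rewrite h. Qed.

Lemma mkpart_perm (s : seq nat) : perm_eq (mkpart s) [seq k <- s | (0 < k)%N].
Proof. by rewrite perm_sort. Qed.

Lemma prod_mkpart (R : comNzRingType) (f : nat -> R) s :
  {in s, forall k, (0 < k)%N} ->
  \prod_(k <- mkpart s) f k = \prod_(k <- s) f k.
Proof.
move=> h; rewrite (perm_big _ (mkpart_perm s)) /=.
by rewrite (all_filterP _) //; apply/allP.
Qed.

Lemma psum_part_mul (la mu : part) :
  psum_part la * psum_part mu = psum_part (mkpart (la ++ mu)).
Proof.
rewrite /psum_part prod_mkpart ?big_cat // => k.
by rewrite mem_cat => /orP[]; exact: part_pos.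
Qed.

Lemma inspan_mul F G :
  inspan psum_part F -> inspan psum_part G -> inspan psum_part (F * G).
Proof.
move=> [c ->] [d ->]; rewrite /lincomb mulr_suml; apply: inspan_sum => la _.
rewrite mulr_sumr; apply: inspan_sum => mu _.
rewrite -scalerAl -scalerAr; do 2!apply: inspanZ.
by rewrite psum_part_mul; exact: inspan_base.
Qed.

Lemma inspan1 : inspan psum_part 1.
Proof.
have -> : 1 = psum_part (mkpart [::]) by rewrite /psum_part prod_mkpart ?big_nil.
exact: inspan_base.
Qed.

Lemma psum_mkpart k : (0 < k)%N -> psum k = psum_part (mkpart [:: k]).
Proof.
move=> k0; rewrite /psum_part prod_mkpart ?big_seq1 // => i.
by rewrite inE => /eqP ->.
Qed.

Lemma inspan_psum k : (0 < k)%N -> inspan psum_part (psum k).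
Proof. by move/psum_mkpart ->; exact: inspan_base. Qed.

Lemma inspan_newton a x : newton a x ->
  (forall k, (0 < k)%N -> inspan psum_part (a k)) ->
  forall n, inspan psum_part (x n).
Proof.
move=> [x0 xS] ha n; elim/ltn_ind: n => -[_|n IH]; first by rewrite x0; exact: inspan1.
have -> : x n.+1 = (n.+1%:R^-1 : Qqt) *: (x n.+1 *+ n.+1).
  by rewrite -scaler_nat scalerA mulVf ?scale1r // nat_Qqt_eq0.
rewrite xS -scaleN1r; do 2!apply: inspanZ.
rewrite big_nat; apply: inspan_sum => k /andP[k0 kn].
by apply: inspan_mul; [exact: ha|apply: IH; rewrite ltn_subrL k0].
Qed.

Lemma inspan_elem n : inspan psum_part (elem n).
Proof.
have -> : elem n = (-1) ^+ n *: eps n.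
  by rewrite /eps scalerA -exprMn mulN1r opprK expr1n scale1r.
by apply: inspanZ; apply: (inspan_newton newton_eps) => k; exact: inspan_psum.
Qed.

Lemma inspan_exp F n : inspan psum_part F -> inspan psum_part (F ^+ n).
Proof.
move=> h; elim: n => [|n IH]; first by rewrite expr0; exact: inspan1.
by rewrite exprS; apply: inspan_mul.
Qed.

Lemma inspan_prod (I : Type) (s : seq I) (f : I -> symfun) :
  (forall i, inspan psum_part (f i)) -> inspan psum_part (\prod_(i <- s) f i).
Proof.
move=> h; elim: s => [|i s IH]; first by rewrite big_nil; exact: inspan1.
by rewrite big_cons; apply: inspan_mul.
Qed.

(** Degrees stay below d, so a monomial in more than d variables misses one of them; symmetry moves
    the missing variable to the last place, where [kill_last] finds the coefficient in one variable
    fewer. Fewer than d variables are reached by [kill_last] directly. *)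
Lemma symfun_eq0 (F : symfun) d :
  (forall N, (msize (sfproj N F) <= d)%N) -> sfproj d F = 0 -> F = 0.
Proof.
case: F => F [sF kF bF]; rewrite /sfproj /= => sz Fd.
apply: symfunP => N /=; have [Nd|dN] := leqP N d.
  have {}Fd : F (d - N + N)%N = 0 by rewrite subnK.
  elim: (d - N)%N Fd => // k IH h; apply: IH.
  have {}h : F (k + N).+1 = 0 by [].
  by rewrite -kF h /kill_last raddf0.
rewrite -(subnK (ltnW dN)); elim: (N - d)%N => // k IH; rewrite addSn.
apply/mpolyP => m; rewrite mcoeff0; apply/eqP; rewrite mcoeff_eq0; apply/negP => h.
have mk : (mdeg m < d)%N.
  by apply: leq_trans (sz (k + d).+1); exact: msize_mdeg_lt.
have /existsP[i0 /eqP i00] : [exists i : 'I_(k + d).+1, m i == 0%N].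
  apply: contraLR mk; rewrite negb_exists => /forallP pos; rewrite -leqNgt mdegE.
  apply: (@leq_trans (k + d).+1); first by rewrite leqW // leq_addl.
  rewrite -[X in (X <= _)%N]card_ord -sum1_card; apply: leq_sum => i _.
  by rewrite lt0n.
pose s := (tperm i0 ord_max)%g.
have := sF (k + d).+1 => /issymP/(_ s) symF.
move: h; rewrite mcoeff_msupp -symF mcoeff_sym => /eqP; apply.
set m' := (X in _@_X); have m'0 : m' ord_max = 0%N.
  by rewrite /m' mnmE tpermR.
have -> : m' = mnmwiden [multinom m' (widen_ord (leqnSn _) i) | i < (k + d)%N].
  apply/mnmP => i; case: (unliftP ord_max i) => [j|] ->.
    have -> : lift ord_max j = widen_ord (leqnSn (k + d)) j.
      by apply: val_inj; rewrite /= /bump leqNgt ltn_ord.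
    by rewrite mnmwiden_widen mnmE.
  by rewrite mnmwiden_ordmax.
by rewrite -mcoeff_kill_last kF IH mcoeff0.
Qed.

(** * Homogeneous symmetric functions *)

Lemma homogeneousM m n F G :
  homogeneous m F -> homogeneous n G -> homogeneous (m + n) (F * G).
Proof. by move=> hF hG N; apply: dhomogM; [exact: hF|exact: hG]. Qed.

Lemma homogeneous1 : homogeneous 0 1.
Proof. by move=> N; exact: dhomog1. Qed.

Lemma homogeneous0 n : homogeneous n 0.
Proof. by move=> N; exact: dhomog0. Qed.

Lemma homogeneousD n F G :
  homogeneous n F -> homogeneous n G -> homogeneous n (F + G).
Proof. by move=> hF hG N; apply: dhomogD; [exact: hF|exact: hG]. Qed.

Lemma homogeneousZ n a F : homogeneous n F -> homogeneous n (a *: F).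
Proof. by move=> hF N; apply: dhomogZ; exact: hF. Qed.

Lemma homogeneous_sum n (I : Type) (s : seq I) (P : pred I) (f : I -> symfun) :
  (forall i, P i -> homogeneous n (f i)) ->
  homogeneous n (\sum_(i <- s | P i) f i).
Proof.
move=> h; elim/big_rec: _ => [|i x Pi IH]; first exact: homogeneous0.
by apply: homogeneousD => //; exact: h.
Qed.

Lemma homogeneous_prod (I : Type) (s : seq I) (d : I -> nat) (f : I -> symfun) :
  (forall i, homogeneous (d i) (f i)) ->
  homogeneous (\sum_(i <- s) d i) (\prod_(i <- s) f i).
Proof.
move=> h; elim: s => [|i s IH]; first by rewrite !big_nil; exact: homogeneous1.
by rewrite !big_cons; apply: homogeneousM.
Qed.

Lemma homogeneous_exp d F n : homogeneous d F -> homogeneous (n * d) (F ^+ n).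
Proof.
move=> h; elim: n => [|n IH]; first by rewrite expr0; exact: homogeneous1.
by rewrite exprS mulSn; exact: homogeneousM.
Qed.

Lemma homogeneous_elem k : homogeneous k (elem k).
Proof. by move=> N; exact: dhomog_mesym. Qed.

Lemma homogeneous_complete k : homogeneous k (complete k).
Proof.
move=> N; apply/dhomogP => m; rewrite mcoeff_msupp [_@__]mcoeff_complete /=.
by case: (mdeg m =P k) => //; rewrite eqxx.
Qed.

Lemma homogeneous_psum k : homogeneous k (psum k).
Proof.
move=> N; rewrite /= /psum_poly; case: eqP => [->|_]; first exact: dhomog0.
apply: rpred_sum => i _; rewrite mpolyXn.
by rewrite dhomogX /= mdegMn mdeg1 mul1n.
Qed.

Lemma homogeneous_msize d F N : homogeneous d F -> (msize (sfproj N F) <= d.+1)%N.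
Proof.
move=> h; apply: msize_leP => m mF; rewrite ltnS.
have /dhomogP hN := h N; by rewrite (hN m) // mcoeff_msupp.
Qed.

Lemma inspan_psum_part F : inspan psum_part F.
Proof.
have [sF _ [d sz]] := sfpolyP F.
have [T [TF wT]] := sym_fundamental (sF d).
(* [G] lifts the expression of F in e_1, ..., e_d from d variables to all of them; the weight bound
   [wT] keeps its degree below d, so agreement in d variables is enough. *)
pose G : symfun := \sum_(m <- msupp T) T@_m *: \prod_(i < d) elem i.+1 ^+ m i.
have -> : F = G.
  apply/eqP; rewrite -subr_eq0; apply/eqP.
  apply: (@symfun_eq0 _ d) => [N|].
    rewrite rmorphB /= (leq_trans (msizeD_le _ _)) // geq_max sz msizeN.
    rewrite /G rmorph_sum /= big_seq (leq_trans (msize_sum _ _ _)) //.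
    apply/bigmax_leqP_seq => m _ mT. rewrite sfprojZ.
    apply: leq_trans (msizeZ_le _ _) _.
    apply: leq_trans (leq_trans wT (sz d)).
    apply: leq_trans (mmeasure_mnm_lt _ mT); apply: homogeneous_msize.
    apply: homogeneous_prod => i; apply: homogeneous_exp.
    exact: homogeneous_elem.
  rewrite rmorphB /= /G rmorph_sum /=; apply/eqP; rewrite subr_eq0 eq_sym.
  rewrite [X in _ == X](esym TF) comp_mpolyE; apply/eqP.
  apply: eq_bigr => m _; rewrite sfprojZ rmorph_prod; congr (_ *: _).
  by apply: eq_bigr => i _; rewrite tnth_mktuple rmorphXn.
apply: inspan_sum => m _; apply: inspanZ; apply: inspan_prod => i.
by apply: inspan_exp; exact: inspan_elem.
Qed.

(** * Linear independence of products of power sums *)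

Definition assign_mnm (s : seq nat) N (f : {ffun 'I_(size s) -> 'I_N}) : 'X_{1..N} :=
  (\sum_(j < size s) U_(f j) *+ nth 0%N s j)%MM.

Lemma assign_mnmE s N f i :
  @assign_mnm s N f i = (\sum_(j < size s | f j == i) nth 0 s j)%N.
Proof.
rewrite mnm_sumE [RHS]big_mkcond /=; apply: eq_bigr => j _.
by rewrite mulmnE mnm1E; case: eqP; rewrite ?mul1n.
Qed.

Lemma sfproj_psum k N : (0 < k)%N -> sfproj N (psum k) = \sum_(i < N) 'X_i ^+ k.
Proof. by rewrite /sfproj /= /psum_poly lt0n => /negbTE ->. Qed.

Lemma sfproj_psum_part (la : part) N :
  sfproj N (psum_part la) =
  \sum_(f : {ffun 'I_(size la) -> 'I_N}) 'X_[assign_mnm f].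
Proof.
rewrite rmorph_prod (eq_big_seq (fun k => \sum_(i < N) 'X_i ^+ k)); last first.
  by move=> k /part_pos; exact: sfproj_psum.
rewrite (big_nth 0%N) big_mkord bigA_distr_bigA /=; apply: eq_bigr => f _.
by rewrite -mprodXE; apply: eq_bigr => j _; rewrite mpolyXn.
Qed.

Definition part_mnm (la : seq nat) : 'X_{1..size la} :=
  [multinom nth 0%N la i | i < size la].

(** All exponents of [part_mnm la] are positive, so f is onto; as mu has no more parts than la, f is
    a bijection that matches the parts. *)
Lemma assign_mnm_perm (la mu : part) (f : {ffun 'I_(size mu) -> 'I_(size la)}) :
  assign_mnm f = part_mnm la -> (size mu <= size la)%N -> mu = la.
Proof.
move=> h szle; apply: part_eqP.
have pos (i : 'I_(size la)) : (0 < nth 0%N la i)%N.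
  by apply: (@part_pos la); exact: mem_nth.
have hi i : (\sum_(j < size mu | f j == i) nth 0 mu j)%N = nth 0%N la i.
  by rewrite -assign_mnmE h mnmE.
have surj i : i \in codom f.
  apply/negPn/negP => no; have := pos i; rewrite -hi big1 // => j /eqP e.
  by case/negP: no; rewrite -e codom_f.
have uf : uniq (codom f).
  apply/card_uniqP; apply/eqP; rewrite eqn_leq card_size /=.
  have -> : #|codom f| = size la.
    by rewrite -[RHS]card_ord; apply: eq_card => i; rewrite surj.
  by rewrite size_codom card_ord.
have injf : injective f by apply/injectiveP.
have -> : (mu : seq nat) = [seq nth 0%N la (i : 'I__) | i <- codom f].
  rewrite /codom /image_mem -map_comp -[LHS](mkseq_nth 0%N) /mkseq -val_enum_ord.
  rewrite -map_comp; apply: eq_map => j /=; rewrite -hi (big_pred1 j) // => j'.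
  by rewrite /= (inj_eq injf).
rewrite -[X in perm_eq _ X](mkseq_nth 0%N) /mkseq -val_enum_ord -map_comp.
apply: (@perm_map _ _ (fun i : 'I_(size la) => nth 0%N la i)).
apply: uniq_perm => //; first exact: enum_uniq.
by move=> i; rewrite surj mem_enum.
Qed.

Lemma mcoeff_psum_part (la mu : part) :
  (size mu <= size la)%N ->
  ((sfproj (size la) (psum_part mu))@_(part_mnm la) == 0) = (mu != la).
Proof.
move=> szle; rewrite sfproj_psum_part raddf_sum /=.
have [e|ne] := eqVneq mu la; last first.
  rewrite big1 ?eqxx // => f _; rewrite mcoeffX; case: eqP => // /assign_mnm_perm.
  by move=> /(_ szle) e; rewrite e eqxx in ne.
subst mu; under eq_bigr do rewrite mcoeffX; rewrite -natr_sum nat_Qqt_eq0.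
apply/negbTE; rewrite -lt0n (bigD1 [ffun i => i]) //= (_ : _ == _) //.
apply/eqP/mnmP => i; rewrite assign_mnmE mnmE (big_pred1 i) // => j.
by rewrite ffunE.
Qed.

Lemma psum_part_free c : lincomb psum_part c = 0 -> c = [fsfun].
Proof.
move=> c0; apply/fsfunP => la0; rewrite fsfun0E; apply/eqP/negPn/negP => cla0.
have x0 : finsupp c.
  by exists la0; rewrite mem_finsupp.
(* For a longest la in the support, x^la occurs in p_mu for no other mu of the support. *)
case: (@arg_maxnP _ x0 xpredT (fun la => size (val la)) isT) => x _ hmax.
set la : part := val x; pose N := size la.
have := congr1 (fun F => (sfproj N F)@_(part_mnm la)) c0.
rewrite /lincomb rmorph_sum /= rmorph0 mcoeff0 raddf_sum /=.
rewrite (big_fsetD1 la) ?(valP x) //= big_seq big1 ?addr0.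
  rewrite linearZ /= => /eqP; rewrite mulf_eq0 mcoeff_psum_part // eqxx orbF.
  by have := valP x; rewrite mem_finsupp => /negbTE ->.
move=> mu; rewrite !inE => /andP[ne hmu]; rewrite linearZ /=.
apply/eqP; rewrite mulf_eq0 mcoeff_psum_part ?ne ?orbT //.
by have := hmax (Sub mu hmu) isT.
Qed.

Lemma psum_part_basis : is_basis psum_part.
Proof. exact: is_basisI inspan_psum_part psum_part_free. Qed.

(** * Ring morphisms out of the ring of symmetric functions *)

Notation pcoords := (coords psum_part).

(** The embedding of the scalars is a parameter so that targets such as {poly symfun}, whose natural
    scalars are [symfun], are covered. *)
Definition plift (R : comNzRingType) (iota : {rmorphism Qqt -> R}) (a : nat -> R)
    (F : symfun) : R :=
  \sum_(la <- finsupp (pcoords F)) iota (pcoords F la) * \prod_(k <- la) a k.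

Section Plift.
Variables (R : comNzRingType) (iota : {rmorphism Qqt -> R}) (a : nat -> R).

Lemma pliftE F (S : {fset part}) : (finsupp (pcoords F) `<=` S)%fset ->
  plift iota a F = \sum_(la <- S) iota (pcoords F la) * \prod_(k <- la) a k.
Proof.
move=> sub; rewrite /plift; apply: big_fset_incl => // la _ h.
by rewrite (fsfun_dflt h) rmorph0 mul0r.
Qed.

Lemma plift_linear b F G :
  plift iota a (b *: F + G) = iota b * plift iota a F + plift iota a G.
Proof.
pose S := (finsupp (pcoords F) `|` finsupp (pcoords G) `|`
  finsupp (pcoords (b *: F + G)%R))%fset.
rewrite !(@pliftE _ S) ?fsubsetUr ?(fsubset_trans (fsubsetUl _ _) (fsubsetUl _ _)) //; last first.
  by apply: fsubset_trans (fsubsetUl _ _); exact: fsubsetUr.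
rewrite mulr_sumr -big_split /=; apply: eq_bigr => la _.
by rewrite (coords_linear psum_part_basis) rmorphD rmorphM mulrDl mulrA.
Qed.

Lemma plift0 : plift iota a 0 = 0.
Proof.
by apply: (addIr (plift iota a 0)); rewrite add0r -{1}[plift _ _ _]mul1r
  -(rmorph1 iota) -plift_linear scale1r addr0.
Qed.

Lemma pliftZ b F : plift iota a (b *: F) = iota b * plift iota a F.
Proof. by rewrite -[b *: F]addr0 plift_linear plift0 addr0. Qed.

Lemma plift_is_zmod_morphism : zmod_morphism (plift iota a).
Proof.
move=> F G; rewrite addrC -scaleN1r plift_linear rmorphN1 mulN1r.
exact: addrC.
Qed.

Lemma plift_psum_part la : plift iota a (psum_part la) = \prod_(k <- la) a k.
Proof.
rewrite (@pliftE _ [fset la]%fset).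
  by rewrite big_seq_fset1 (coords_base psum_part_basis) eqxx rmorph1 mul1r.
apply/fsubsetP => mu; rewrite mem_finsupp (coords_base psum_part_basis) inE.
by case: (mu == la); rewrite ?eqxx.
Qed.

Lemma pliftM F G : plift iota a (F * G) = plift iota a F * plift iota a G.
Proof.
elim/(basis_ind psum_part_basis) : F => [|b F F' IH IH'|la].
- by rewrite mul0r plift0 mul0r.
- by rewrite mulrDl -scalerAl !plift_linear IH IH' mulrDl mulrA.
elim/(basis_ind psum_part_basis) : G => [|b G G' IH IH'|mu].
- by rewrite mulr0 plift0 mulr0.
- by rewrite mulrDr -scalerAr !plift_linear IH IH' mulrDr mulrCA.
rewrite psum_part_mul !plift_psum_part prod_mkpart ?big_cat // => k.
by rewrite mem_cat => /orP[]; exact: part_pos.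
Qed.

Lemma plift_is_monoid_morphism : monoid_morphism (plift iota a).
Proof.
split; last exact: pliftM.
have -> : 1 = psum_part (mkpart [::]) by rewrite /psum_part prod_mkpart ?big_nil.
by rewrite plift_psum_part prod_mkpart ?big_nil.
Qed.

HB.instance Definition _ :=
  GRing.isZmodMorphism.Build symfun R (plift iota a) plift_is_zmod_morphism.
HB.instance Definition _ :=
  GRing.isMonoidMorphism.Build symfun R (plift iota a) plift_is_monoid_morphism.

Lemma plift_psum k : (0 < k)%N -> plift iota a (psum k) = a k.
Proof.
move=> k0; rewrite psum_mkpart // plift_psum_part prod_mkpart ?big_seq1 // => i.
by rewrite inE => /eqP ->.
Qed.

Lemma plift_alg c : plift iota a c%:A = iota c.
Proof. by rewrite pliftZ rmorph1 mulr1. Qed.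

End Plift.

(** Power sums generate the ring over the scalars. Identities between plethystic alphabets reduce by
    this to one identity for each p_k. *)
Lemma sfmorph_eq (R : comNzRingType) (f g : {rmorphism symfun -> R}) :
  (forall c, f c%:A = g c%:A) ->
  (forall k, (0 < k)%N -> f (psum k) = g (psum k)) -> f =1 g.
Proof.
move=> fgA fgp F; elim/(basis_ind psum_part_basis): F => [|b F G IH IH'|la].
- by rewrite !rmorph0.
- by rewrite !rmorphD -mulr_algl !rmorphM fgA IH IH'.
rewrite !rmorph_prod; apply: eq_big_seq => k /part_pos; exact: fgp.
Qed.

Lemma plethysmE (R : comAlgType Qqt) (a : nat -> R) :
  plethysm a =1 plift (in_alg R) a.
Proof.
move=> F; rewrite /plethysm /linext /lincomb /plift.
by apply: eq_bigr => la _; rewrite mulr_algl.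
Qed.

Lemma homogeneous_psum_part (la : part) : homogeneous (sumn la) (psum_part la).
Proof.
rewrite sumnE; apply: homogeneous_prod; exact: homogeneous_psum.
Qed.

Lemma homogeneous_coords (b : part -> symfun) (bb : is_basis b) n F la :
  (forall mu : part, homogeneous (sumn mu) (b mu)) ->
  homogeneous n F -> coords b F la != 0 -> sumn la = n.
Proof.
move=> hb hF; pose c := coords b F.
pose G : symfun := \sum_(la <- finsupp c | sumn la == n) c la *: b la.
have FG : F = G.
  apply: sfproj_eq => N; rewrite -[LHS](pihomog_dE (hF N)) -/(sfproj N F).
  rewrite {1}[F](coordsP bb) /lincomb /G !rmorph_sum  /= raddf_sum.
  rewrite [RHS]big_mkcond /=; apply: eq_bigr => mu _.
  have h := homogeneousZ (c mu) (hb mu) N.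
  case: eqP => e; first by rewrite pihomog_dE // -e.
  by rewrite (pihomog_ne0 _ h) //; exact/eqP.
have : F = lincomb b [fsfun mu in finsupp c => c mu *+ (sumn mu == n) | 0].
  rewrite lincomb_fsfun {1}FG /G big_mkcond; apply: eq_bigr => mu _.
  by case: eqP; rewrite ?mulr1n ?mulr0n ?scale0r.
move/(congr1 (fun F => coords b F la)); rewrite (coords_lincomb bb).
move=> ->; rewrite fsfunE; case: ifP => _; last by rewrite eqxx.
by case: (sumn la =P n) => //; rewrite mulr0n eqxx.
Qed.

Lemma homogeneous_ind n (P : symfun -> Prop) :
  P 0 -> (forall a F G, P F -> P G -> P (a *: F + G)) ->
  (forall la : part, sumn la = n -> P (psum_part la)) ->
  forall F, homogeneous n F -> P F.
Proof.
move=> P0 PD Pb F hF; rewrite [F](coordsP psum_part_basis) /lincomb.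
rewrite big_seq; elim/big_rec: _ => // la G hla PG; apply: PD => //.
by apply: Pb; apply: (homogeneous_coords psum_part_basis homogeneous_psum_part hF); rewrite -mem_finsupp.
Qed.

(** * The Macdonald operator and its commutation with skewing *)

Notation sfconst := (polyC \o in_alg symfun).

(* [F[X - (1-u) y]], where [y] is the polynomial variable. *)
Definition removal (u : Qqt) : symfun -> {poly symfun} :=
  plift sfconst (fun k => (psum k)%:P - ((1 - u ^+ k)%:A)%:P * 'X^k).

HB.instance Definition _ u := GRing.RMorphism.copy (removal u)
  (plift sfconst (fun k => (psum k)%:P - ((1 - u ^+ k)%:A)%:P * 'X^k)).

Definition strip u k F : symfun := (removal u F)`_k.

(* [F[X + (1-q)(1-t) w]], where [w] is the polynomial variable. *)
Definition addition : symfun -> {poly symfun} :=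
  plift sfconst
    (fun k => (psum k)%:P + (((1 - q ^+ k) * (1 - t ^+ k))%:A)%:P * 'X^k).

HB.instance Definition _ := GRing.RMorphism.copy addition
  (plift sfconst
    (fun k => (psum k)%:P + (((1 - q ^+ k) * (1 - t ^+ k))%:A)%:P * 'X^k)).

(* The coefficient of [z^m] in [F[X + (1-q)(1-t)/z] sum_i (-z)^i e_i]; [macD 0] is the Macdonald operator. *)
Definition macD m F : symfun :=
  \sum_(i < size (addition F)) eps (i + m) * (addition F)`_i.

Lemma removal_psum u k : (0 < k)%N ->
  removal u (psum k) = (psum k)%:P - ((1 - u ^+ k)%:A)%:P * 'X^k.
Proof. exact: plift_psum. Qed.

Lemma addition_psum k : (0 < k)%N -> addition (psum k) =
  (psum k)%:P + (((1 - q ^+ k) * (1 - t ^+ k))%:A)%:P * 'X^k.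
Proof. exact: plift_psum. Qed.

Lemma removal_alg u c : removal u c%:A = (c%:A)%:P.
Proof. exact: plift_alg. Qed.

Lemma addition_alg c : addition c%:A = (c%:A)%:P.
Proof. exact: plift_alg. Qed.

Lemma strip_linear u k : linear (strip u k).
Proof.
move=> a F G; rewrite /strip rmorphD coefD; congr (_ + _).
by rewrite -mulr_algl rmorphM /= removal_alg coefCM mulr_algl.
Qed.

HB.instance Definition _ u k :=
  GRing.isLinear.Build Qqt symfun symfun _ (strip u k) (strip_linear u k).

Lemma addition0 F : (addition F)`_0 = F.
Proof.
rewrite -horner_coef0.
apply: (@sfmorph_eq _ (horner_eval 0 \o addition) idfun) => [c|k k0] /=.
  by rewrite addition_alg /horner_eval hornerC.
by rewrite addition_psum // /horner_eval !hornerE expr0n gtn_eqF // mulr0 addr0.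
Qed.

Lemma macDE m F B : (size (addition F) <= B)%N ->
  macD m F = \sum_(i < B) eps (i + m) * (addition F)`_i.
Proof.
move=> sB; rewrite /macD (big_ord_widen B (fun i => eps (i + m) * (addition F)`_i)) //.
rewrite big_mkcond; apply: eq_bigr => i _; case: ltnP => // h.
by rewrite nth_default ?mulr0.
Qed.

Lemma macD_linear m : linear (macD m).
Proof.
move=> a F G; pose B := maxn (size (addition (a *: F + G)))
  (maxn (size (addition F)) (size (addition G))).
rewrite !(@macDE _ _ B) ?leq_max ?leqnn ?orbT //.
rewrite scaler_sumr -big_split /=; apply: eq_bigr => i _.
rewrite -mulr_algl rmorphD rmorphM /= addition_alg coefD coefCM mulrDr.
by rewrite mulrCA mulr_algl.
Qed.

HB.instance Definition _ m :=
  GRing.isLinear.Build Qqt symfun symfun _ (macD m) (macD_linear m).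

(** The coefficients of (1 - u w) / (1 - w), the factor that sum eps_n z^n acquires under X -> X -
    (1-u) y, with w = z y. *)
Definition gcoef (u : Qqt) s : Qqt := if s is 0%N then 1 else 1 - u.

Lemma strip_eps u j s :
  strip u s (eps j) = if (s <= j)%N then gcoef u s *: eps (j - s) else 0.
Proof.
pose c := conv (fun n => (eps n)%:P) (fun n => 'X^n : {poly symfun}).
have n1 := newton_conv (newton_map (@polyC symfun) newton_eps) (newton_geom 'X).
have n2 := newton_conv n1 (newton_lin (u%:A%:P * 'X)).
have n3 := newton_map (removal u) newton_eps.
have tf : torsion_free {poly symfun} by apply/torsion_free_poly/torsion_free_symfun.
have e : removal u (eps j) = c j - (if j is j'.+1 then c j' * (u%:A%:P * 'X) else 0).
  rewrite -(conv_lin c); apply: (newton_unique tf n3).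
  apply: eq_newton n2 => // k k0; rewrite /= removal_psum // exprMn -rmorphXn /=.
  have -> : (u%:A : symfun) ^+ k = (u ^+ k)%:A by rewrite exprZn expr1n.
  rewrite scalerBl scale1r rmorphB /= polyC1; ring.
have cc n i : (c n)`_i = if (i <= n)%N then eps (n - i) else 0.
  rewrite /c /conv coef_sum; case: leqP => h.
    rewrite (bigD1 (inord (n - i))) //= inordK ?ltnS ?leq_subr // subKn //.
    rewrite coefCM coefXn eqxx mulr1 big1 ?addr0 // => l ne.
    rewrite coefCM coefXn; case: eqP => [e'|]; rewrite ?mulr0 //.
    case/eqP: ne; apply: val_inj; rewrite /= inordK ?ltnS ?leq_subr // e'.
    by rewrite subKn // -ltnS.
  rewrite big1 // => l _; rewrite coefCM coefXn; case: eqP => [e'|]; rewrite ?mulr0 //.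
  by move: h; rewrite e' ltnNge leq_subr.
rewrite /strip e coefB cc; case: j {e} => [|j].
  by rewrite coef0 subr0; case: s => //= ; rewrite scale1r.
rewrite mulrA coefMX coefMC; case: s => [|s] /=; first by rewrite subr0 scale1r.
rewrite cc subSS ltnS; case: leqP => _; last by rewrite mul0r subr0.
by rewrite mulr_algr scalerBl scale1r.
Qed.

Lemma stripM u k F G :
  strip u k (F * G) = \sum_(s < k.+1) strip u s F * strip u (k - s) G.
Proof. by rewrite /strip rmorphM coefM. Qed.

Lemma strip_eps_mul u k j F :
  strip u k (eps j * F) =
  \sum_(s < k.+1 | (s <= j)%N) gcoef u s *: (eps (j - s) * strip u (k - s) F).
Proof.
rewrite stripM [RHS]big_mkcond; apply: eq_bigr => s _.
by rewrite strip_eps; case: ifP => _; rewrite ?mul0r // scalerAl.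
Qed.

(** Two shifts of the alphabet commute; [swapXY] only reorders the two polynomial variables. *)
Lemma strip_addition u k i F :
  strip u k (addition F)`_i = (addition (strip u k F))`_i.
Proof.
pose f := [the {rmorphism _ -> _} of swapXY \o map_poly (removal u) \o addition].
pose g := [the {rmorphism _ -> _} of map_poly addition \o removal u].
have fg : f =1 g.
  apply: sfmorph_eq => [c|k' k0] /=.
    by rewrite addition_alg removal_alg !map_polyC /= addition_alg removal_alg swapXY_polyC map_polyC.
  rewrite addition_psum // removal_psum // !rmorphD !rmorphN !rmorphM /=.
  rewrite !map_polyC /= removal_alg addition_alg removal_psum // addition_psum //.
  rewrite !map_polyXn !rmorphXn /= swapXY_X !swapXY_polyC !map_polyC /=.
  rewrite rmorphB rmorphM /= !map_polyC map_polyXn /= rmorphD rmorphM rmorphXn /=.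
  by rewrite addrAC.
have := congr1 (fun p : {poly {poly symfun}} => p`_k`_i) (fg F); rewrite /= coef_swapXY !coef_map /=.
by [].
Qed.

Lemma coef_comp_scaleX (R : comNzRingType) (p : {poly R}) c N :
  (p \Po (c%:P * 'X))`_N = c ^+ N * p`_N.
Proof.
rewrite comp_polyE coef_sum.
under eq_bigr do rewrite exprMn -rmorphXn /= coefZ coefCM coefXn.
have [h|h] := ltnP N (size p).
  rewrite (bigD1 (Ordinal h)) //= eqxx mulr1 big1 ?addr0; first by rewrite mulrC.
  move=> i ne; case: eqP => [e|]; rewrite ?mulr0 //.
  by case/eqP: ne; apply: val_inj.
rewrite nth_default // mulr0 big1 // => i _.
by case: eqP => [e|]; rewrite ?mulr0 //; move: h; rewrite e leqNgt ltn_ord.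
Qed.

Lemma coef_horner_X (R : comNzRingType) (p : {poly {poly R}}) N :
  (p.['X])`_N = \sum_(i < N.+1) p`_i`_(N - i).
Proof.
rewrite horner_coef coef_sum.
under eq_bigr do rewrite coefMXn.
have big (B : nat) : (size p <= B)%N -> (N < B)%N ->
    \sum_(i < size p) (if (N < i)%N then 0 else p`_i`_(N - i)) =
    \sum_(i < B) (if (N < i)%N then 0 else p`_i`_(N - i)).
  move=> sB _; rewrite (big_ord_widen B (fun i => if (N < i)%N then 0 else p`_i`_(N - i))) //.
  rewrite big_mkcond; apply: eq_bigr => i _; case: ltnP => // h.
  by rewrite (nth_default 0 h) coef0 if_same.
pose B := maxn (size p) N.+1.
rewrite (big B) ?leq_maxl ?leq_maxr //.
rewrite (big_ord_widen B (fun i => p`_i`_(N - i))) ?leq_maxr //.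
by rewrite [RHS]big_mkcond; apply: eq_bigr => i _; rewrite ltnS; case: leqP.
Qed.

Section Commutation.
Variables u v : Qqt.
Hypothesis uv : forall k, (1 - u ^+ k) * (1 - v ^+ k) = (1 - q ^+ k) * (1 - t ^+ k).

(** When both variables equal y, the shifts combine to X - (1-u) y + (1-u)(1-v) y = X - (1-u) v y,
    that is, y is replaced by v y. *)
Lemma strip_addition_diag N F :
  \sum_(i < N.+1) strip u (N - i) (addition F)`_i = v ^+ N *: strip u N F.
Proof.
pose f := [the {rmorphism _ -> _} of
  horner_eval ('X : {poly symfun}) \o map_poly (removal u) \o addition].
pose g := [the {rmorphism _ -> _} of
  comp_poly ((v%:A : symfun)%:P * 'X) \o removal u].
have fg : f =1 g.
  apply: sfmorph_eq => [c|k k0] /=.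
    by rewrite addition_alg removal_alg map_polyC /= removal_alg /horner_eval hornerC comp_polyC.
  rewrite addition_psum // removal_psum // rmorphD rmorphM /= !map_polyC map_polyXn.
  rewrite /horner_eval !hornerE /= removal_alg removal_psum // rmorphB rmorphM /=.
  rewrite !comp_polyC -uv [in RHS]rmorphXn /= comp_polyX exprMn -!rmorphXn /=.
  have -> : (v%:A : symfun) ^+ k = (v ^+ k)%:A by rewrite exprZn expr1n.
  have -> : ((1 - u ^+ k) * (1 - v ^+ k))%:A =
     (1 - u ^+ k)%:A * (1 - (v ^+ k)%:A) :> symfun.
    by rewrite -scalerA mulr_algl; congr (_ *: _); rewrite scalerBl scale1r.
  rewrite rmorphM rmorphB rmorph1; ring.
have := congr1 (fun p : {poly symfun} => p`_N) (fg F).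
rewrite /= /horner_eval coef_horner_X coef_comp_scaleX.
rewrite exprZn expr1n mulr_algl => <-; apply: eq_bigr => i _.
by rewrite coef_map.
Qed.

(* The series identity [A(y) D(z) = (1 - u z y)/(1 - z y) D(z) A(y)], in which
   the expansion of [1/(1 - z y)] is traded for the opposite one plus the residue
   at [z = 1/y], where [D(z) A(y)] becomes [F[X - (1-u) v y]] times the
   series in the [e_i]; this way only operators [D_m] with [m >= 0] occur. *)
Lemma strip_macD m k F : exists B B',
  (k < B)%N /\
  strip u k (macD m F) =
    u *: macD m (strip u k F)
    + (1 - u) *: (\sum_(N < B | (k <= N + m)%N)
                    v ^+ N *: (eps (N + m - k) * strip u N F))
    - (1 - u) *: \sum_(r < B') macD (m + r.+1) (strip u (k + r.+1) F).
Proof.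
pose G i l := strip u l (addition F)`_i.
pose A := size (addition F).
(* [B] exceeds both degrees of the double family [G], so that all sums run over a square; it also
   exceeds k, to keep the index N = k in range. *)
pose B := maxn (maxn A (\max_(i < A) size (removal u (addition F)`_i)%R)) k.+1.
have AB : (A <= B)%N by rewrite !leq_max leqnn.
have kB : (k < B)%N by rewrite leq_max leqnn orbT.
have Gi i l : (B <= i)%N -> G i l = 0.
  move=> h; rewrite /G nth_default ?linear0 //.
  exact: leq_trans AB h.
have Gl i l : (B <= l)%N -> G i l = 0.
  move=> h; have [iA|Ai] := ltnP i A; last by rewrite /G nth_default ?linear0.
  rewrite /G /strip nth_default // (leq_trans _ h) // !leq_max.
  by rewrite (leq_bigmax (Ordinal iA)) orbT.
have macG m' l : macD m' (strip u l F) = \sum_(i < B) eps (i + m') * G i l.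
  rewrite (@macDE _ _ B); last first.
    by apply/leq_sizeP => i Bi; rewrite -strip_addition; exact: Gi.
  by apply: eq_bigr => i _; rewrite -strip_addition.
pose E N := if (k <= N + m)%N then eps (N + m - k) else 0.
pose row l := \sum_(i < B) E (i + l)%N * G i l.
(* The rows l < k are what commuting produces ([LT]). They are replaced by [W] minus the rows l = k
   and l > k, and [W] itself is summed along the diagonals i + l = N by [strip_addition_diag]. *)
pose W := \sum_(l < B) row l.
pose L := \sum_(l < k) row l.
pose T := macD m (strip u k F).
pose R := \sum_(r < B - k.+1) macD (m + r.+1) (strip u (k + r.+1) F).
have WLTR : W = L + T + R.
  rewrite /W -(big_mkord xpredT row) (big_cat_nat _ (n := k.+1)) //=.
  rewrite big_mkord big_ord_recr /=; congr (_ + _ + _).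
    rewrite /T macG; apply: eq_bigr => i _; rewrite /E addnAC leq_addl.
    by rewrite addnK.
  rewrite -{1}[k.+1]add0n big_addn big_mkord; apply: eq_bigr => r _.
  rewrite macG (_ : (r + k.+1)%N = (k + r.+1)%N); last by rewrite addnC addSnnS.
  apply: eq_bigr => i _; rewrite /E.
  have -> : (i + (k + r.+1) + m = i + (m + r.+1) + k)%N.
    by lia.
  by rewrite leq_addl addnK.
have WS : W = \sum_(N < B + B | (k <= N + m)%N)
                    v ^+ N *: (eps (N + m - k) * strip u N F).
  transitivity (\sum_(N < B + B) \sum_(i < B + B | (i <= N)%N) E N * G i (N - i)%N).
    rewrite (exchange_big_dep xpredT) //= big_split_ord /= [X in _ + X]big1; last first.
      by move=> i _; rewrite big1 // => N _; rewrite Gi ?mulr0 ?leq_addr.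
    rewrite addr0 /W exchange_big; apply: eq_bigr => i _.
    rewrite -(big_geq_mkord i (B + B) xpredT (fun N => E N * G i (N - i)%N)).
    rewrite -{3}[i : nat]add0n big_addn big_mkord.
    rewrite (big_ord_widen (B + B - i) (fun l => E (i + l)%N * G i l)); last first.
      by rewrite -addnBA ?leq_addr // ltnW.
    rewrite big_mkcond; apply: eq_bigr => l _; rewrite addnK addnC.
    by case: ltnP => // h; rewrite Gl ?mulr0.
  rewrite [RHS]big_mkcond; apply: eq_bigr => N _.
  have -> : \sum_(i < B + B | (i <= N)%N) E N * G i (N - i)%N =
            E N * \sum_(i < N.+1) G i (N - i)%N.
    rewrite mulr_sumr (big_ord_widen (B + B) (fun i => E N * G i (N - i)%N)) //.
  rewrite strip_addition_diag /E; case: ifP => _; rewrite ?mul0r //.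
  by rewrite scalerAr.
have LT : strip u k (macD m F) = T + (1 - u) *: L.
  rewrite (@macDE _ _ B) // linear_sum /=.
  under eq_bigr => i _.
    rewrite strip_eps_mul big_mkcond big_ord_recl /= subn0 subn0 scale1r.
    over.
  rewrite big_split /= -macG; congr (_ + _).
  rewrite exchange_big /= scaler_sumr (reindex_inj rev_ord_inj) /=.
  apply: eq_bigr => j _; rewrite scaler_sumr; apply: eq_bigr => i _.
  rewrite /bump /= add1n subnSK // subKn ?(ltnW (ltn_ord j)) //.
  rewrite /E leq_subLR addnCA addnA; case: ifP => h; last by rewrite mul0r scaler0.
  by rewrite /= -/(G i j) subnBA ?(ltnW (ltn_ord j)) // [(i + m + j)%N]addnAC.
exists (B + B)%N, (B - k.+1)%N; split; first by rewrite ltn_addl.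
rewrite -WS -/T -/R WLTR LT.
have {1}-> : T = u *: T + (1 - u) *: T by rewrite -scalerDl addrC subrK scale1r.
by rewrite !scalerDr !addrA addrK addrAC.
Qed.
End Commutation.

(** * Words: coefficients of plethystic evaluations *)

Definition par (b : bool) : Qqt := if b then q else t.

Lemma par_pair b k :
  (1 - par b ^+ k) * (1 - par (~~ b) ^+ k) = (1 - q ^+ k) * (1 - t ^+ k).
Proof. by case: b; rewrite // mulrC. Qed.

Definition aug : symfun -> Qqt := plift idfun (fun _ => 0).
HB.instance Definition _ := GRing.RMorphism.copy aug (plift idfun (fun _ => 0)).

Lemma augZ a F : aug (a *: F) = a * aug F.
Proof. exact: pliftZ. Qed.

Lemma aug_psum k : (0 < k)%N -> aug (psum k) = 0.
Proof. exact: plift_psum. Qed.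

Lemma aug_eps j : aug (eps j) = (j == 0%N)%:R.
Proof.
have [e0 eS] := newton_map aug newton_eps.
case: j => [|j]; first exact: e0.
apply: (@torsion_free_Qqt _ j); rewrite eS big_nat big1 ?oppr0 // => k /andP[k0 _].
by rewrite /= aug_psum // mul0r.
Qed.

(* The coefficient of the monomial of exponents [ks] in [F[- sum_i (1 - par b_i) y_i]]. *)
Fixpoint word (bs : seq bool) (ks : seq nat) (F : symfun) : Qqt :=
  match bs, ks with
  | b :: bs', k :: ks' => word bs' ks' (strip (par b) k F)
  | _, _ => aug F
  end.

Lemma word_linear bs ks : scalar (word bs ks).
Proof.
elim: bs ks => [|b bs IH] [|k ks] a F G /=; rewrite ?linearP ?IH //;
by rewrite rmorphD /= augZ.
Qed.

HB.instance Definition _ bs ks :=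
  GRing.isLinear.Build Qqt symfun Qqt *%R (word bs ks) (word_linear bs ks).

(* Dominance up to a loss of total degree [m]; [w] and [w'] need not be sorted. *)
Definition raises m (w' w : seq nat) :=
  [/\ size w' = size w, sumn w = (sumn w' + m)%N &
      forall i, (sumn (take i w) <= sumn (take i w') + m)%N].

Lemma raises_cons m m' k k' w' w :
  raises m' w' w -> (k + m' = k' + m)%N -> raises m (k' :: w') (k :: w).
Proof.
move=> [sz tot part] e; split => [||[|i]] /=; rewrite ?sz //; first by lia.
by have := part i; lia.
Qed.

Lemma word_eps bs ks j F : size ks = size bs ->
  (forall ks', raises j ks' ks -> word bs ks' F = 0) ->
  word bs ks (eps j * F) = 0.
Proof.
elim: bs ks j F => [|b bs IH] [|k ks] j F //= sz H.
  rewrite rmorphM /= aug_eps; case: j H => [|j] H; last by rewrite mul0r.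
  by rewrite (H [::]) ?mulr0.
rewrite strip_eps_mul linear_sum big1 // => s sj; rewrite linearZ /= IH ?mulr0 //.
  by case: sz.
move=> ks' d; apply: (H ((k - s)%N :: ks')); apply: raises_cons d _.
by have := ltn_ord s; lia.
Qed.

(** The diagonal entry of [macD 0]: the terms of [strip_macD] that keep the exponents are u times
    the operator on the remaining letters and, from N = k, the term (1 - u) v^k. *)
Fixpoint wordev (bs : seq bool) (ks : seq nat) : Qqt :=
  match bs, ks with
  | b :: bs', k :: ks' =>
      par b * wordev bs' ks' + (1 - par b) * par (~~ b) ^+ k
  | _, _ => 1
  end.

(** Triangularity along [raises m]. The induction needs every m, because the last sum in
    [strip_macD] raises the first exponent by r + 1 and passes [macD (m + r.+1)] to the remaining
    letters. *)
Lemma word_macD bs ks m F : size ks = size bs ->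
  (forall ks', raises m ks' ks -> (m == 0%N -> ks' <> ks) -> word bs ks' F = 0) ->
  word bs ks (macD m F) = wordev bs ks * word bs ks F *+ (m == 0%N).
Proof.
elim: bs ks m F => [|b bs IH] [|k ks] m F //= sz H.
  rewrite mul1r /macD rmorph_sum /=.
  have h i : aug (eps (i + m) * (addition F)`_i) =
      aug F *+ ((i == 0%N) && (m == 0%N)).
    rewrite rmorphM /= aug_eps addn_eq0; case: eqP => [->|_]; last by rewrite mul0r.
    by rewrite addition0 mulr_natl.
  under eq_bigr do rewrite h.
  case E: (size (addition F)) => [|s].
    rewrite big_ord0; suff -> : F = 0 by rewrite rmorph0 mul0rn.
    by rewrite -[F]addition0 nth_default ?E.
  by rewrite big_ord_recl /= big1 ?addr0.
case: sz => sz.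
have [B [B' [kB ->]]] := strip_macD (@par_pair b) m k F.
rewrite linearB linearD !linearZ /= IH //; last first.
  move=> ks' d ne; apply: (H (k :: ks')); first exact: raises_cons d _.
  by move=> /ne h [].
rewrite !linear_sum [X in _ - _ * X]big1 ?mulr0 ?subr0; last first.
  move=> r _ /=; rewrite IH //; first by rewrite [(m + _)%N]addnS.
  move=> ks' d _; apply: (H ((k + r.+1)%N :: ks')).
    by apply: raises_cons d _; lia.
  by move=> _ [] /eqP; rewrite -{2}[k]addn0 eqn_add2l.
have hN (N : 'I_B) : (k <= N + m)%N ->
   word bs ks (par (~~ b) ^+ N *: (eps (N + m - k) * strip (par b) N F)) =
   (par (~~ b) ^+ k * word bs ks (strip (par b) k F)) *+ ((m == 0%N) && (N == k :> nat)).
  move=> kN; rewrite linearZ /=; have [/andP[/eqP m0 /eqP e]|ne] := boolP (_ && _).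
    rewrite m0 e addn0 subnn (_ : eps 0 = 1) ?mul1r //.
    by have [-> _] := newton_eps.
  rewrite word_eps ?mulr0 // => ks' d; apply: (H ((N : nat) :: ks')).
    by apply: raises_cons d _; lia.
  by move=> m0 [e _]; case/negP: ne; rewrite m0 e eqxx.
rewrite (eq_bigr _ (fun N kN => hN N kN)).
case: eqP => [->|_]; last by rewrite big1 ?mulr0 ?addr0 ?mulr0.
rewrite !mulr1n (bigD1 (Ordinal kB)) /= ?addn0 // eqxx mulr1n big1 ?addr0.
  by rewrite [RHS]mulrDl -!mulrA.
by move=> i /andP[_ /negbTE ne]; rewrite -val_eqE /= in ne; rewrite ne.
Qed.

(** * Monomials in q and t *)

Definition weight (c : nat * nat) : Qqt := q ^+ c.1 * t ^+ c.2.

Definition weight_mnm (c : nat * nat) : 'X_{1..2} :=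
  (U_(@ord0 1) *+ c.1 + U_(@ord_max 1) *+ c.2)%MM.

Lemma weight_mnm_inj : injective weight_mnm.
Proof.
move=> [i j] [i' j'] /mnmP e; have := e ord0; have := e ord_max.
rewrite !mnmDE !mulmnE !mnm1E /= => e1 e2; congr pair; lia.
Qed.

Lemma weightE c : weight c = tofrac 'X_[weight_mnm c].
Proof. by rewrite /weight /q /t -!tofracXn -tofracM !mpolyXn -mpolyXD. Qed.

(** Monomials q^i t^j are linearly independent over the rationals, where multiplicities remain
    distinct. *)
Lemma weight_sum_inj (s1 s2 : seq (nat * nat)) :
  \sum_(c <- s1) weight c = \sum_(c <- s2) weight c -> perm_eq s1 s2.
Proof.
have E s : \sum_(c <- s) weight c =
    tofrac (\sum_(c <- s) 'X_[weight_mnm c] : {mpoly rat[2]}).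
  by rewrite rmorph_sum /=; apply: eq_bigr => c _; exact: weightE.
rewrite !E => /eqP; rewrite tofrac_eq => /eqP h.
have C (s : seq (nat * nat)) x :
    (\sum_(c <- s) 'X_[weight_mnm c] : {mpoly rat[2]})@_(weight_mnm x) = (count_mem x s)%:R.
  rewrite raddf_sum -sum1_count natr_sum [RHS]big_mkcond /=; apply: eq_bigr => c _.
  by rewrite mcoeffX (inj_eq weight_mnm_inj); case: eqP.
apply/allP => x _ /=; have := congr1 (mcoeff (weight_mnm x)) h; rewrite !C.
by move/eqP; rewrite Num.Theory.eqr_nat.
Qed.

Lemma weight_inj : injective weight.
Proof.
move=> c c' h; have := @weight_sum_inj [:: c] [:: c'].
by rewrite !big_seq1 => /(_ h) /perm_mem /(_ c); rewrite !inE eqxx => /esym/eqP.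
Qed.

Lemma weight_neq0 c : weight c != 0.
Proof.
apply/eqP => h; have := @weight_sum_inj [:: c] [::].
by rewrite big_seq1 big_nil => /(_ h) /perm_size.
Qed.

Lemma weight00 : weight (0%N, 0%N) = 1.
Proof. by rewrite /weight !expr0 mulr1. Qed.

Lemma par_exp_neq1 b k : (0 < k)%N -> par b ^+ k != 1.
Proof.
move=> k0; apply/eqP; rewrite -weight00.
have -> : par b ^+ k = weight (if b then (k, 0%N) else (0%N, k)).
  by case: b; rewrite /weight /par /= expr0 ?mulr1 ?mul1r.
by move/weight_inj; case: b => -[e]; rewrite e in k0.
Qed.

Lemma par_neq0 b : par b != 0.
Proof.
by case: b; [have := weight_neq0 (1%N, 0%N)|have := weight_neq0 (0%N, 1%N)];
  rewrite /weight /par /= expr0 expr1 ?mulr1 ?mul1r.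
Qed.

(** * Homogeneity and separation by words *)

(** For k > n truncated subtraction would still admit constants, whereas a coefficient beyond degree
    n is 0. *)
Definition lowered n k (F : symfun) :=
  if (k <= n)%N then homogeneous (n - k) F else F = 0.

Lemma lowered0 n k : lowered n k 0.
Proof. by rewrite /lowered; case: ifP => // _; exact: homogeneous0. Qed.

Lemma loweredP n k a F G : lowered n k F -> lowered n k G -> lowered n k (a *: F + G).
Proof.
rewrite /lowered; case: ifP => _; last by move=> -> ->; rewrite scaler0 addr0.
by move=> hF hG; apply: homogeneousD => //; exact: homogeneousZ.
Qed.

Lemma lowered_coef (f : {rmorphism symfun -> {poly symfun}}) (c : nat -> Qqt) n F :
  (forall a, f a%:A = (a%:A)%:P) ->
  (forall k, (0 < k)%N -> f (psum k) = (psum k)%:P + ((c k)%:A)%:P * 'X^k) ->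
  homogeneous n F -> forall k, lowered n k (f F)`_k.
Proof.
move=> fA fp; elim/homogeneous_ind => [k|a {}F G IH1 IH2 k|la <-].
- by rewrite rmorph0 coef0; exact: lowered0.
- by rewrite rmorphD -mulr_algl rmorphM /= fA coefD coefCM mulr_algl; exact: loweredP.
rewrite /psum_part; have : {in (la : seq nat), forall k, (0 < k)%N} by move=> k; exact: part_pos.
elim: (la : seq nat) => [|j s IH] pos k.
  rewrite big_nil rmorph1 coef1 /lowered; case: k => //=; exact: homogeneous1.
have {}IH : forall k, lowered (sumn s) k (f (\prod_(i <- s) psum i))`_k.
  by apply: IH => i h; apply: pos; rewrite inE h orbT.
rewrite big_cons rmorphM /= fp ?pos ?mem_head // mulrDl coefD coefCM.
rewrite -mulrA coefCM coefXnM mulr_algl addrC; apply: loweredP.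
  case: ltnP => [_|jk]; first exact: lowered0.
  have := IH (k - j)%N; rewrite /lowered leq_subLR.
  by case: ifP => // _; rewrite (_ : (_ - _ = j + sumn s - k)%N) //=; lia.
have := IH k; rewrite /lowered; case: leqP => h.
  rewrite (leq_trans h) ?leq_addl // => hF.
  by rewrite -addnBA //; apply: homogeneousM => //; exact: homogeneous_psum.
by move=> ->; rewrite mulr0; exact: lowered0.
Qed.

Lemma addition_homogeneous n F k : homogeneous n F -> lowered n k (addition F)`_k.
Proof.
by move=> hF; apply: lowered_coef hF k; [exact: addition_alg|exact: addition_psum].
Qed.

Lemma homogeneous_eps j : homogeneous j (eps j).
Proof. by apply: homogeneousZ; exact: homogeneous_elem. Qed.

Lemma macD0_homogeneous n F : homogeneous n F -> homogeneous n (macD 0 F).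
Proof.
move=> hF; apply: homogeneous_sum => i _; rewrite addn0.
have := addition_homogeneous i hF; rewrite /lowered; case: ifP => [h hG|_ ->].
  by rewrite -(subnKC h); apply: homogeneousM => //; exact: homogeneous_eps.
by rewrite mulr0; exact: homogeneous0.
Qed.

Definition scalep (c : nat -> Qqt) : symfun -> symfun :=
  plift (in_alg symfun) (fun k => c k *: psum k).
HB.instance Definition _ c := GRing.RMorphism.copy (scalep c)
  (plift (in_alg symfun) (fun k => c k *: psum k)).

Lemma scalep_psum c k : (0 < k)%N -> scalep c (psum k) = c k *: psum k.
Proof. exact: plift_psum. Qed.

Lemma scalep_alg c a : scalep c a%:A = a%:A.
Proof. exact: plift_alg. Qed.

Lemma scalepZ c a F : scalep c (a *: F) = a *: scalep c F.
Proof. by rewrite -[RHS]mulr_algl; exact: pliftZ. Qed.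

Lemma scalep_homogeneous n F c : homogeneous n F -> homogeneous n (scalep c F).
Proof.
elim/homogeneous_ind => [|a {}F G IH1 IH2|la <-].
- by rewrite rmorph0; exact: homogeneous0.
- by rewrite rmorphD /= scalepZ; apply: homogeneousD => //; exact: homogeneousZ.
rewrite rmorph_prod sumnE.
have : {in (la : seq nat), forall k, (0 < k)%N} by move=> k; exact: part_pos.
elim: (la : seq nat) => [|k s IH] pos; first by rewrite !big_nil; exact: homogeneous1.
rewrite !big_cons; apply: homogeneousM.
  rewrite /= scalep_psum ?pos ?mem_head //.
  by apply: homogeneousZ; exact: homogeneous_psum.
by apply: IH => i h; apply: pos; rewrite inE h orbT.
Qed.

Lemma scalepK c : (forall k, (0 < k)%N -> c k != 0) ->
  cancel (scalep c) (scalep (fun k => (c k)^-1)).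
Proof.
move=> c0; apply: (@sfmorph_eq _ (scalep (fun k => (c k)^-1) \o scalep c) idfun).
  by move=> a /=; rewrite !scalep_alg.
by move=> k k0 /=; rewrite scalep_psum // scalepZ scalep_psum // scalerA mulfV ?scale1r ?c0.
Qed.

(* [flip u F] is F[-(1-u)X]. *)
Definition flip (u : Qqt) : symfun -> symfun := scalep (fun k => u ^+ k - 1).

(** * Words in equal letters as coefficients of polynomials *)

Lemma mcoeff_muni N (p : {mpoly Qqt[N.+1]}) (m : 'X_{1..N.+1}) :
  p@_m = ((muni p)`_(m ord_max))@_[multinom m (widen_ord (leqnSn N) i) | i < N].
Proof.
rewrite muniE coef_sum raddf_sum {1}[p]mpolyE raddf_sum /=.
apply: eq_bigr => m' _; rewrite mcoeffZ mcoeffX coefZ coefXn.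
have [e|ne] := eqVneq (m' ord_max) (m ord_max); last first.
  rewrite mulr0 mcoeff0; case: eqP => [e|_]; last by rewrite mulr0.
  by rewrite e eqxx in ne.
rewrite mulr1 mcoeffZ mcoeffX; congr (_ * _%:R); congr nat_of_bool.
apply/eqP/eqP => [->|/mnmP h]; first by apply/mnmP => i; rewrite !mnmE.
apply/mnmP => i; case: (unliftP ord_max i) => [j|] -> //.
have -> : lift ord_max j = widen_ord (leqnSn N) j.
  by apply: val_inj; rewrite /= /bump leqNgt ltn_ord.
by have := h j; rewrite !mnmE.
Qed.

(** Reversed, because [word] reads exponents from the left while [muni] splits off the last
    variable. *)
Definition word_mnm N (ks : seq nat) : 'X_{1..N} :=
  [multinom nth 0%N ks (N.-1 - i) | i < N].

Lemma muni_psum k N : (0 < k)%N ->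
  muni (sfproj N.+1 (psum k)) = (sfproj N (psum k))%:P + 'X^k.
Proof.
move=> k0; rewrite !sfproj_psum // rmorph_sum /= big_ord_recr /=.
have muniX (i : 'I_N.+1) : muni ('X_i : {mpoly Qqt[N.+1]}) =
    if unlift ord_max i is Some j then ('X_j)%:P else 'X.
  rewrite muniE msuppX big_seq1 mcoeffX eqxx scale1r.
  case: unliftP => [j|] ->.
    rewrite mnm1E eq_sym (negbTE (neq_lift _ _)) expr0 alg_polyC; congr ('X_[_])%:P.
    apply/mnmP => i'; rewrite mnmE !mnm1E -val_eqE /= /bump leqNgt ltn_ord.
    by [].
  rewrite mnm1E eqxx expr1 (_ : [multinom _ | _ < _] = 0%MM) ?mpolyX0 ?scale1r //.
  apply/mnmP => i'; rewrite mnmE mnm1E mnm0E -val_eqE /=.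
  by case: eqP => // e; have := ltn_ord i'; rewrite -e ltnn.
rewrite rmorphXn /= muniX unlift_none; congr (_ + _).
rewrite rmorph_sum /=; apply: eq_bigr => i _; rewrite !rmorphXn /= muniX.
have -> : widen_ord (leqnSn N) i = lift ord_max i.
  by apply: val_inj; rewrite /= /bump leqNgt ltn_ord.
by rewrite liftK.
Qed.

(* [alph N u F] is F[-(1-u)(x_1 + ... + x_N)]. *)
Definition alph N (u : Qqt) : symfun -> {mpoly Qqt[N]} :=
  plift (@mpolyC N Qqt) (fun k => - ((1 - u ^+ k)%:MP * sfproj N (psum k))).
HB.instance Definition _ N u := GRing.RMorphism.copy (alph N u)
  (plift (@mpolyC N Qqt) (fun k => - ((1 - u ^+ k)%:MP * sfproj N (psum k)))).

Lemma alph_alg N u c : alph N u c%:A = c%:MP.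
Proof. exact: plift_alg. Qed.

Lemma alph_psum N u k : (0 < k)%N ->
  alph N u (psum k) = - ((1 - u ^+ k)%:MP * sfproj N (psum k)).
Proof. exact: plift_psum. Qed.

Lemma alphZ N u c F : alph N u (c *: F) = c *: alph N u F.
Proof. by rewrite -mul_mpolyC; exact: pliftZ. Qed.

Lemma alphE N u F : alph N u F = sfproj N (flip u F).
Proof.
apply: (@sfmorph_eq _ (alph N u) (sfproj N \o scalep _)) => [c|k k0] /=.
  by rewrite alph_alg scalep_alg sfprojZ rmorph1 alg_mpolyC.
by rewrite alph_psum // scalep_psum // sfprojZ mul_mpolyC -scaleNr opprB.
Qed.

Lemma muni_alph N u F k : (muni (alph N.+1 u F))`_k = alph N u (strip u k F).
Proof.
pose f := [the {rmorphism _ -> _} of @muni N Qqt \o alph N.+1 u].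
pose g := [the {rmorphism _ -> _} of map_poly (alph N u) \o removal u].
have fg : f =1 g.
  apply: sfmorph_eq => [c|j j0] /=.
    by rewrite removal_alg map_polyC /= !alph_alg muniC.
  rewrite removal_psum // alph_psum // muniN muniM muniC muni_psum //.
  rewrite [RHS]rmorphB [X in _ = _ - X]rmorphM /= !map_polyC map_polyXn /= alph_psum // alph_alg.
  by rewrite mulrDr opprD polyCN polyCM.
have := congr1 (fun p : {poly {mpoly Qqt[N]}} => p`_k) (fg F).
by rewrite /= coef_map.
Qed.

Lemma word_mcoeff b N ks F : size ks = N ->
  word (nseq N b) ks F = (alph N (par b) F)@_(word_mnm N ks).
Proof.
elim: N ks F => [|N IH] [|k ks] F //= sz.
  have -> : word_mnm 0 [::] = 0%MM by apply/mnmP => -[].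
  pose f := [the {rmorphism _ -> _} of mcoeff 0%MM \o alph 0 (par b)].
  apply: (@sfmorph_eq _ (@aug) f) => [c|k k0] /=.
    by rewrite /aug plift_alg alph_alg mcoeffC eqxx mulr1.
  rewrite aug_psum // alph_psum // sfproj_psum // big_ord0.
  by rewrite mulr0 oppr0 mcoeff0.
rewrite mcoeff_muni muni_alph mnmE subnn /= IH; last by case: sz.
congr (_ @_ _); apply/mnmP => i; rewrite !mnmE /=.
by have := ltn_ord i; case: (N) i => // N' i iN; rewrite /= subSn.
Qed.

(** These words are the coefficients of [flip (par b) F], from which F is recovered since no power
    u^k with k > 0 is 1. The n + 1 variables come from [symfun_eq0], whose bound is on [msize], the
    degree plus one. *)
Lemma word_separates b n F : homogeneous n F ->
  (forall ks, size ks = n.+1 -> sumn ks = n -> word (nseq n.+1 b) ks F = 0) ->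
  F = 0.
Proof.
move=> hF H; have hf : homogeneous n (flip (par b) F) by exact: scalep_homogeneous.
have c0 k : (0 < k)%N -> par b ^+ k - 1 != 0.
  by move=> k0; rewrite subr_eq0 par_exp_neq1.
rewrite -[F](scalepK c0) -/(flip (par b) F); suff -> : flip (par b) F = 0 by rewrite rmorph0.
apply: (@symfun_eq0 _ n.+1) => [N|]; first exact: homogeneous_msize.
apply/mpolyP => m; rewrite mcoeff0; apply/eqP/negPn/negP => ne.
pose ks := rev (m : seq nat); case/eqP: (ne).
have -> : m = word_mnm n.+1 ks.
  apply/mnmP => i; rewrite mnmE /ks nth_rev size_tuple; last by rewrite ltnS leq_subr.
  rewrite subSS subKn; last by rewrite -ltnS.
  by rewrite (mnm_nth 0).
have sz : size ks = n.+1 by rewrite size_rev size_tuple.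
rewrite -alphE -word_mcoeff // H // /ks sumn_rev sumnE.
have /dhomogP/(_ m) := hf n.+1; rewrite mcoeff_msupp => /(_ ne) e.
apply: etrans e; rewrite [RHS]mdegE big_tuple.
by apply: eq_bigr => i _; rewrite (mnm_nth 0) (tnth_nth 0%N).
Qed.

(** * Dominance *)

Local Open Scope nat_scope.

Lemma sorted_geq_nth (s : seq nat) i j :
  sorted geq s -> i <= j -> nth 0 s j <= nth 0 s i.
Proof.
move=> so ij; have [js|sj] := ltnP j (size s); last by rewrite [nth 0 s j]nth_default.
have tr : transitive geq by move=> a b c; rewrite /geq /= => h1 h2; exact: leq_trans h2 h1.
have := sorted_leq_nth tr (fun x => leqnn x) 0 so; apply; rewrite ?inE //.
exact: leq_ltn_trans ij js.
Qed.

Lemma sumn_take (s : seq nat) r : sumn (take r s) = \sum_(i < r) nth 0 s i.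
Proof.
elim: r s => [|r IH] [|x s]; rewrite ?take0 ?big_ord0 //=.
  by rewrite big1 // => i _; rewrite nth_nil.
by rewrite big_ord_recl /= IH.
Qed.

(** For a partition, the sum of the first k parts of its conjugate. *)
Definition capped (k : nat) (s : seq nat) := \sum_(x <- s) minn x k.
Definition excess (k : nat) (s : seq nat) := \sum_(x <- s) (x - k).

Lemma capped_excess k s : capped k s + excess k s = sumn s.
Proof. by rewrite sumnE /capped /excess -big_split; apply: eq_bigr => x _ /=; lia. Qed.

(** Half of a duality: for sorted s the bound is attained at k = nth 0 s r when r is given, and at
    the number r of parts above k when k is given. This is how dominance passes to conjugates. *)
Lemma excess_ge k r s : sumn (take r s) <= excess k s + r * k.
Proof.
rewrite /excess; elim: s r => [|x s IH] [|r] //=.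
by rewrite big_cons; have := IH r; lia.
Qed.

Lemma excess_sorted s r : sorted geq s ->
  excess (nth 0 s r) s + r * nth 0 s r = sumn (take r s).
Proof.
elim: s r => [|x s IH] r so; first by rewrite nth_nil muln0 /excess big_nil.
case: r => [|r] /=; last first.
  have := IH r (path_sorted so); rewrite /excess big_cons mulSn.
  by have := @sorted_geq_nth (x :: s) 0 r.+1 so isT; rewrite /=; lia.
rewrite /excess addn0 big_seq big1 // => y ys.
have := @sorted_geq_nth (x :: s) 0 (index y (x :: s)) so isT.
by rewrite nth_index //= => h; apply/eqP; rewrite subn_eq0.
Qed.

Lemma excess_count k s : sorted geq s ->
  excess k s + count (fun x => k < x) s * k = sumn (take (count (fun x => k < x) s) s).
Proof.
elim: s => [|x s IH] so; first by rewrite /excess big_nil.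
rewrite /excess big_cons /=; have := IH (path_sorted so); rewrite /excess.
case: ltnP => kx; first by rewrite add1n /= mulSn; lia.
rewrite add0n.
have -> : count (fun x => k < x) s = 0.
  apply/eqP; rewrite -leqn0 leqNgt -has_count; apply/hasPn => y ys.
  have := @sorted_geq_nth (x :: s) 0 (index y (x :: s)) so isT.
  by rewrite nth_index ?inE ?ys ?orbT //= -leqNgt => h; exact: leq_trans h kx.
by rewrite !take0; lia.
Qed.

Lemma take_inj_sum (s s' : seq nat) : size s = size s' ->
  (forall i, sumn (take i s) = sumn (take i s')) -> s = s'.
Proof.
move=> sz h; apply: (@eq_from_nth _ 0) => // i _.
by have := h i.+1; rewrite !sumn_take !big_ord_recr /= -!sumn_take h => /addnI.
Qed.

Lemma sumn_uniq (s : seq nat) : uniq s -> \sum_(i < size s) i <= sumn s.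
Proof.
move E : (size s) => n; elim: n s E => [|n IH] s sz us; first by rewrite big_ord0.
have [/hasP[x xs nx]|/hasPn no] := boolP (has (fun x => n <= x) s).
  rewrite (perm_sumn (perm_to_rem xs)) /= big_ord_recr /= addnC leq_add //.
  by apply: IH; rewrite ?size_rem ?sz ?rem_uniq.
have : size s <= size (iota 0 n).
  by apply: uniq_leq_size => // x /no; rewrite mem_iota -ltnNge.
by rewrite size_iota sz ltnn.
Qed.

Lemma sum_perm_ge l (s : {perm 'I_l}) r : r <= l ->
  \sum_(i < r) i <= \sum_(i < l | i < r) s i.
Proof.
move=> rl; pose x := [seq nat_of_ord (s (widen_ord rl i)) | i <- enum 'I_r].
have ux : uniq x.
  rewrite map_inj_uniq ?enum_uniq // => i j /ord_inj/perm_inj/(congr1 val) /= h.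
  exact: val_inj.
have := sumn_uniq ux; rewrite size_map size_enum_ord => h; apply: leq_trans h _.
rewrite sumnE big_map big_enum /=.
rewrite (big_ord_narrow rl) //=.
Qed.

Lemma jt_size (la : seq nat) (s : {perm 'I_(size la)}) :
  (forall i : 'I_(size la), i <= nth 0 la i + s i) ->
  \sum_(i < size la) (nth 0 la i + s i - i) = sumn la.
Proof.
move=> pos; rewrite sumnE (big_nth 0) big_mkord.
apply: (@addIn (\sum_(i < size la) i)); rewrite -big_split /=.
rewrite (eq_bigr (fun i : 'I__ => nth 0 la i + s i)) => [|i _]; last by rewrite subnK.
by rewrite big_split /=; congr (_ + _); rewrite [RHS](reindex_inj (@perm_inj _ s)).
Qed.

(** The first r values of s are distinct naturals, so the exponents la_i - i + s_i have partial sums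
    at least those of la, hence of mu. This bounds their excess over k from below, while their total
    is fixed. *)
Lemma jt_capped (la mu : seq nat) (s : {perm 'I_(size la)}) k :
  sorted geq mu -> dominates la mu ->
  (forall i : 'I_(size la), i <= nth 0 la i + s i) ->
  \sum_(i < size la) minn (nth 0 la i + s i - i) k <= capped k mu.
Proof.
move=> so [tot part] pos; set l := size la.
pose b (i : 'I_l) := nth 0 la i + s i - i.
have bi i : b i + i = nth 0 la i + s i by rewrite subnK.
have tb : \sum_i b i = sumn mu by rewrite -tot; exact: jt_size.
have e1 : \sum_i minn (b i) k + \sum_i (b i - k) = \sum_i b i.
  by rewrite -big_split; apply: eq_bigr => i _ /=; lia.
rewrite -[X in X <= _]/(\sum_i minn (b i) k).
suff h : excess k mu <= \sum_i (b i - k) by have := capped_excess k mu; lia.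
(* At this r, [excess_count] is an equality for mu; [r'] cuts r down to the length of la. *)
pose r := count (fun x => k < x) mu; pose r' := minn r l.
have r'l : r' <= l by rewrite geq_minr.
have ec := excess_count k so; rewrite -/r in ec.
have h1 : sumn (take r la) = \sum_(i < l | i < r') nth 0 la i.
  have -> : take r la = take r' la.
    by rewrite /r'; case: leqP => // h; rewrite take_size take_oversize // ltnW.
  by rewrite sumn_take [RHS](big_ord_narrow r'l).
have h2 : \sum_(i < l | i < r') nth 0 la i <= \sum_(i < l | i < r') b i.
  have := sum_perm_ge s r'l.
  have -> : \sum_(i < r') i = \sum_(i < l | i < r') i by rewrite [RHS](big_ord_narrow r'l).
  have : \sum_(i < l | i < r') b i + \sum_(i < l | i < r') i =
    \sum_(i < l | i < r') nth 0 la i + \sum_(i < l | i < r') s i.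
    by rewrite -!big_split; apply: eq_bigr => i _; exact: bi.
  by move=> e h; rewrite -(leq_add2r (\sum_(i < l | i < r') i)) e leq_add2l.
have h3 : \sum_(i < l | i < r') b i <= \sum_i (b i - k) + r' * k.
  rewrite [X in _ <= X + _](bigID (fun i : 'I_l => i < r')) /=.
  have -> : r' * k = \sum_(i < l | i < r') k.
    by rewrite (big_ord_narrow r'l) sum_nat_const card_ord.
  rewrite addnAC -big_split /= (leq_trans _ (leq_addr _ _)) //.
  by apply: leq_sum => i _; rewrite addnC -leq_subLR.
have h4 := part r.
have h5 : r' * k <= r * k by rewrite leq_mul2r geq_minl orbT.
lia.
Qed.

Local Open Scope ring_scope.

(** * Degree in the last variables, and Schur functions *)

Definition last_deg N k (d : nat) (p : {mpoly Qqt[N]}) :=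
  forall m : 'X_{1..N}, p@_m != 0 -> (\sum_(i < N | N - k <= i) m i <= d)%N.

Lemma last_deg0 N k d : last_deg k d (0 : {mpoly Qqt[N]}).
Proof. by move=> m; rewrite mcoeff0 eqxx. Qed.

Lemma last_deg_le N k d d' (p : {mpoly Qqt[N]}) :
  (d <= d')%N -> last_deg k d p -> last_deg k d' p.
Proof. by move=> dd h m /h h'; exact: leq_trans h' dd. Qed.

Lemma last_degD N k d (p r : {mpoly Qqt[N]}) :
  last_deg k d p -> last_deg k d r -> last_deg k d (p + r).
Proof.
move=> hp hr m; rewrite mcoeffD; have [->|/hp //] := eqVneq (p@_m) 0.
by rewrite add0r; exact: hr.
Qed.

Lemma last_degZ N k d c (p : {mpoly Qqt[N]}) :
  last_deg k d p -> last_deg k d (c *: p).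
Proof.
by move=> hp m; rewrite mcoeffZ mulf_eq0 negb_or => /andP[_]; exact: hp.
Qed.

Lemma last_deg_sum N k d (I : Type) (s : seq I) (P : pred I) (f : I -> {mpoly Qqt[N]}) :
  (forall i, P i -> last_deg k d (f i)) -> last_deg k d (\sum_(i <- s | P i) f i).
Proof.
move=> h; elim/big_rec: _ => [|i x Pi IH]; first exact: last_deg0.
by apply: last_degD; [exact: h|exact: IH].
Qed.

Lemma last_degM N k d d' (p r : {mpoly Qqt[N]}) :
  last_deg k d p -> last_deg k d' r -> last_deg k (d + d') (p * r).
Proof.
move=> hp hr m; rewrite -mcoeff_msupp => /msuppM_le/allpairsP[[m1 m2] /= [h1 h2 ->]].
under eq_bigr do rewrite mnmDE; rewrite big_split leq_add //=.
  by apply: hp; rewrite -mcoeff_msupp.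
by apply: hr; rewrite -mcoeff_msupp.
Qed.

Lemma last_deg1 N k d : last_deg k d (1 : {mpoly Qqt[N]}).
Proof.
move=> m; rewrite mcoeff1; case: (m =P 0%MM) => [-> _|_]; last by rewrite eqxx.
by rewrite big1 // => i _; rewrite mnm0E.
Qed.

Lemma last_deg_prod N k (I : Type) (s : seq I) (d : I -> nat) (f : I -> {mpoly Qqt[N]}) :
  (forall i, last_deg k (d i) (f i)) ->
  last_deg k (\sum_(i <- s) d i) (\prod_(i <- s) f i).
Proof.
move=> h; elim: s => [|i s IH]; first by rewrite !big_nil; exact: last_deg1.
by rewrite !big_cons; apply: last_degM; [exact: h|exact: IH].
Qed.

(** The monomials of e_j are squarefree, so each of the last k variables counts at most once. *)
Lemma last_deg_mesym N k j : last_deg k (minn j k) (mesym N Qqt j).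
Proof.
move=> m; rewrite mcoeff_mesym; case E : (mechar j m); last by rewrite eqxx.
move=> _; case/andP: E => /eqP <- /forallP m1; rewrite leq_min; apply/andP; split.
  rewrite mdegE [X in (_ <= X)%N](bigID (fun i : 'I_N => N - k <= i)%N) /=.
  exact: leq_addr.
apply: (@leq_trans (\sum_(i < N | N - k <= i) 1)%N).
  by apply: leq_sum => i _; exact: m1.
rewrite (reindex_inj rev_ord_inj) /= (bigID (fun i : 'I_N => i < k)%N) /=.
rewrite [X in (_ + X)%N]big1 ?addn0; last by move=> i; have := ltn_ord i; lia.
apply: (@leq_trans (\sum_(i < N | (i < k)%N) 1)%N).
  rewrite [X in (X <= _)%N]big_mkcond [X in (_ <= X)%N]big_mkcond /=.
  by apply: leq_sum => i _; case: (i < k)%N; rewrite ?andbF ?andbT //; case: ifP.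
have [kN|Nk] := leqP k N; first by rewrite (big_ord_narrow kN) sum1_card card_ord.
apply: (@leq_trans N); last exact: ltnW.
rewrite -[X in (_ <= X)%N]card_ord -sum1_card big_mkcond /=.
by apply: leq_sum => i _; case: ifP.
Qed.

Lemma alph0_complete N j : alph N 0 (complete j) = (-1) ^+ j *: mesym N Qqt j.
Proof.
have tf : torsion_free {mpoly Qqt[N]} by exact: torsion_free_lmod.
have n1 := newton_map (alph N 0) newton_complete.
apply: (newton_unique tf n1 (y := fun n => (-1) ^+ n *: mesym N Qqt n)).
apply: eq_newton (newton_mesym N) => // k k0.
rewrite rmorphN /= alph_psum // expr0n gtn_eqF // subr0 mul1r opprK.
by [].
Qed.

(** The parameter 0 stands for the alphabet -X. The span conditions thus become statements about
    s_la[-X]. *)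
Lemma alph_pleth N u F : alph N u F = alph N 0 (pleth_x1m u F).
Proof.
rewrite /pleth_x1m plethysmE.
apply: (@sfmorph_eq _ (alph N u)
  (alph N 0 \o plift (in_alg symfun) (fun k => (1 - u ^+ k) *: psum k))) => [c|k k0] /=.
  by rewrite plift_alg !alph_alg.
have -> : plift (in_alg symfun) (fun k => (1 - u ^+ k) *: psum k) (psum k) =
    (1 - u ^+ k) *: psum k by exact: plift_psum.
rewrite alphZ (alph_psum N u k0) (alph_psum N 0 k0) expr0n gtn_eqF // subr0.
by rewrite mul1r scalerN mul_mpolyC.
Qed.

(** At -X the Jacobi-Trudi entries become signed e_j, and a product of e_(b_i) has degree at most
    sum_i min(b_i, k) in k variables. *)
Lemma last_deg_schur N k (la mu : seq nat) :
  sorted geq mu -> dominates la mu -> last_deg k (capped k mu) (alph N 0 (schur la)).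
Proof.
move=> so dm; rewrite /schur -det_map_mx /determinant.
apply: last_deg_sum => s _; rewrite mulr_sign -(@scaler_sign Qqt); apply: last_degZ.
have [h|] := boolP [forall i : 'I_(size la), i <= nth 0 la i + s i]%N.
  have {}h i := forallP h i.
  apply: last_deg_le (jt_capped k so dm h) _.
  apply: last_deg_prod => i; rewrite !mxE h /= alph0_complete; apply: last_degZ.
  exact: last_deg_mesym.
rewrite negb_forall => /existsP[i hi]; rewrite (bigD1 i) //= !mxE (negbTE hi).
rewrite rmorph0 mul0r; exact: last_deg0.
Qed.

Lemma word_capped b N ks (mu : seq nat) F k : size ks = N -> sorted geq mu ->
  in_schur_span (fun la => dominates la mu) (pleth_x1m (par b) F) ->
  (capped k mu < sumn (take k ks))%N -> word (nseq N b) ks F = 0.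
Proof.
move=> sz so [c cP eF] lt; rewrite word_mcoeff // alph_pleth eF.
have h : last_deg k (capped k mu) (alph N 0 (lincomb schur c)).
  rewrite /lincomb rmorph_sum big_seq; apply: last_deg_sum => la hla.
  rewrite /= alphZ; apply: last_degZ; apply: last_deg_schur => //; exact: cP.
apply/eqP/negPn/negP => /h; rewrite leqNgt => /negP; apply.
(* By the reversal in [word_mnm], the first k letters are the last k variables. *)
apply: (leq_trans lt); rewrite (reindex_inj rev_ord_inj) /=.
have -> : (\sum_(i < N | N - k <= N - i.+1) word_mnm N ks (rev_ord i) =
           \sum_(i < N | i < k) nth 0 ks i)%N.
  apply: eq_big => [i|i _]; first by have := ltn_ord i; lia.
  by rewrite mnmE /=; congr nth; have := ltn_ord i; lia.
have [kN|Nk] := leqP k N; first by rewrite sumn_take (big_ord_narrow kN).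
rewrite take_oversize; last by rewrite sz ltnW.
rewrite -{1}[ks]take_size sumn_take sz.
by apply: eq_leq; apply: eq_bigl => i; rewrite (ltn_trans (ltn_ord i)).
Qed.

(** * Cells of a word *)

Definition M : Qqt := (1 - q) * (1 - t).

Lemma M_neq0 : M != 0.
Proof.
rewrite mulf_neq0 // subr_eq0 eq_sym.
  by have := @par_exp_neq1 true 1 isT; rewrite expr1.
by have := @par_exp_neq1 false 1 isT; rewrite expr1.
Qed.

(* A letter [true] of exponent [k] adds a column of height [k], a letter [false]
   a row of length [k], starting at the current corner [(a, b)]. *)
Fixpoint wcells (a b : nat) (bs : seq bool) (ks : seq nat) : seq (nat * nat) :=
  match bs, ks with
  | true :: bs', k :: ks' => [seq (a, b + j)%N | j <- iota 0 k] ++ wcells a.+1 b bs' ks'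
  | false :: bs', k :: ks' => [seq (a + i, b)%N | i <- iota 0 k] ++ wcells a b.+1 bs' ks'
  | _, _ => [::]
  end.

Lemma geom_sum (x : Qqt) k : (1 - x) * (\sum_(j <- iota 0 k) x ^+ j) = 1 - x ^+ k.
Proof.
rewrite -[k in iota _ k]subn0 -/(index_iota 0 k) big_mkord -opprB mulNr -subrX1.
by rewrite opprB.
Qed.

(** One letter of the recursion: x is the weight of the current corner, G the geometric sum over a
    strip of k cells, and W the entry of the remaining letters, whose corner has weight u x. *)
Lemma wordev_step (u v x W G S' : Qqt) k :
  (1 - u) * (1 - v) = M -> (1 - v) * G = 1 - v ^+ k ->
  u * x * W = u * x - M * S' ->
  x * (u * W + (1 - u) * v ^+ k) = x - M * (x * G + S').
Proof.
move=> <- eG eW.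
have -> : x * (u * W + (1 - u) * v ^+ k) = u * x * W + x * (1 - u) * v ^+ k by ring.
have -> : (1 - u) * (1 - v) * (x * G + S') =
  (1 - u) * x * ((1 - v) * G) + (1 - u) * (1 - v) * S' by ring.
by rewrite eW eG -/M; ring.
Qed.

Lemma wordev_cells_gen a b bs ks : size ks = size bs ->
  weight (a, b) * wordev bs ks =
  weight (a, b) - M * \sum_(c <- wcells a b bs ks) weight c.
Proof.
elim: bs ks a b => [|[] bs IH] [|k ks] a b //=.
- by rewrite big_nil mulr0 subr0 mulr1.
- move=> [sz]; rewrite big_cat big_map /=.
  have -> : \sum_(j <- iota 0 k) weight (a, (b + j)%N) =
      weight (a, b) * \sum_(j <- iota 0 k) t ^+ j.
    by rewrite mulr_sumr; apply: eq_bigr => j _; rewrite /weight /= exprD mulrA.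
  apply: wordev_step; [by []|exact: geom_sum|].
  have -> : q * weight (a, b) = weight (a.+1, b) by rewrite /weight /= exprS mulrA.
  exact: IH.
- move=> [sz]; rewrite big_cat big_map /=.
  have -> : \sum_(j <- iota 0 k) weight ((a + j)%N, b) =
      weight (a, b) * \sum_(j <- iota 0 k) q ^+ j.
    by rewrite mulr_sumr; apply: eq_bigr => j _; rewrite /weight /= exprD mulrAC.
  apply: wordev_step; [by rewrite mulrC|exact: geom_sum|].
  have -> : t * weight (a, b) = weight (a, b.+1) by rewrite /weight /= exprS mulrCA.
  exact: IH.
Qed.

Definition shapeev (s : seq (nat * nat)) : Qqt := 1 - M * \sum_(c <- s) weight c.

Lemma wordev_cells bs ks : size ks = size bs ->
  wordev bs ks = shapeev (wcells 0 0 bs ks).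
Proof. by move/(@wordev_cells_gen 0 0); rewrite weight00 !mul1r. Qed.

Lemma shapeev_inj s s' : shapeev s = shapeev s' -> perm_eq s s'.
Proof.
rewrite /shapeev => /addrI/oppr_inj/(mulfI M_neq0); exact: weight_sum_inj.
Qed.

Lemma mem_wcells_rows N b ks i j : size ks = N ->
  ((i, j) \in wcells 0 b (nseq N false) ks) = (b <= j)%N && (i < nth 0%N ks (j - b))%N.
Proof.
elim: N b ks => [|N IH] b [|k ks] //=; first by rewrite nth_nil andbF.
move=> [sz]; rewrite mem_cat IH //.
have -> : ((i, j) \in [seq (0 + i0, b)%N | i0 <- iota 0 k]) = (i < k)%N && (j == b).
  apply/mapP/andP => [[i' + [-> ->]]|[ik /eqP ->]].
    by rewrite mem_iota /= add0n => ->.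
  by exists i; rewrite ?mem_iota.
have [lt|lt|->] := ltngtP j b; rewrite ?andbF ?andbT ?subnn ?orbF //=.
by rewrite -(subnSK lt).
Qed.

Lemma mem_wcells_cols N a ks i j : size ks = N ->
  ((i, j) \in wcells a 0 (nseq N true) ks) = (a <= i)%N && (j < nth 0%N ks (i - a))%N.
Proof.
elim: N a ks => [|N IH] a [|k ks] //=; first by rewrite nth_nil andbF.
move=> [sz]; rewrite mem_cat IH //.
have -> : ((i, j) \in [seq (a, 0 + j0)%N | j0 <- iota 0 k]) = (j < k)%N && (i == a).
  apply/mapP/andP => [[i' + [-> ->]]|[ik /eqP ->]].
    by rewrite mem_iota /= add0n => ->.
  by exists j; rewrite ?mem_iota.
have [lt|lt|->] := ltngtP i a; rewrite ?andbF ?andbT ?subnn ?orbF //=.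
by rewrite -(subnSK lt).
Qed.

Lemma wcells_rows b ks :
  wcells 0 b (nseq (size ks) false) ks =
  [seq (i, (b + j)%N) | j <- iota 0 (size ks), i <- iota 0 (nth 0%N ks j)].
Proof.
elim: ks b => [|k ks IH] b //=; rewrite addn0; congr (_ ++ _).
rewrite IH (iotaDl 1) /allpairs_dep -map_comp; congr flatten.
by apply: eq_map => j /=; rewrite addSnnS.
Qed.

Lemma cells_pad (mu : seq nat) r :
  wcells 0 0 (nseq (size mu + r) false) (mu ++ nseq r 0%N) = cells mu.
Proof.
have -> : (size mu + r = size (mu ++ nseq r 0))%N by rewrite size_cat size_nseq.
rewrite wcells_rows size_cat size_nseq iotaD allpairs_cat.
rewrite [X in _ ++ X](_ : _ = [::]) ?cats0.
  congr flatten; apply/eq_in_map => j; rewrite mem_iota /= add0n => jm.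
  by rewrite nth_cat jm.
have : {in iota (0 + size mu)%N r, forall j, size mu <= j}%N.
  by move=> j; rewrite mem_iota add0n => /andP[].
elim: (iota _ _) => //= j l IH h; rewrite IH ?cats0.
  rewrite nth_cat ltnNge h ?mem_head //= nth_nseq; by case: ifP.
by move=> i il; apply: h; rewrite inE il orbT.
Qed.

Lemma nth_le_sumn (s : seq nat) i : (nth 0 s i <= sumn s)%N.
Proof.
elim: s i => [|x s IH] [|i] //=; first exact: leq_addr.
by rewrite (leq_trans (IH i)) ?leq_addl.
Qed.

Lemma sum_ltn x k : (\sum_(i < k) (i < x) = minn x k)%N.
Proof.
elim: k => [|k IH]; first by rewrite big_ord0 minn0.
by rewrite big_ord_recr /= IH; lia.
Qed.

(* Equal eigenvalues give equal sets of cells, so the columns [al] and the rows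
   [be] describe the same diagram; in particular [be] is sorted. *)
Lemma shape_eq n (al be mu : seq nat) :
  size al = n.+1 -> size be = n.+1 -> sumn al = n -> sumn be = n -> sumn mu = n ->
  size mu = n.+1 ->
  (forall k, sumn (take k al) <= capped k mu)%N ->
  (forall k, sumn (take k be) <= sumn (take k mu))%N ->
  wordev (nseq n.+1 true) al = wordev (nseq n.+1 false) be -> be = mu.
Proof.
move=> sal sbe tal tbe tmu smu ub1 ub2.
rewrite !wordev_cells ?size_nseq // => /shapeev_inj/perm_mem e.
have mem i j : (j < nth 0 al i)%N = (i < nth 0 be j)%N.
  by have := e (i, j); rewrite mem_wcells_cols // mem_wcells_rows // !subn0.
have so : sorted geq be.
  apply: (@path_sorted _ _ (sumn be)); apply/(pathP 0%N) => i ib.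
  case: i ib => [|i] ib /=.
    rewrite sumnE (big_nth 0%N) big_mkord (bigD1 (Ordinal ib)) //=; exact: leq_addr.
  rewrite /geq /= leqNgt; apply/negP; rewrite -mem => /ltnW.
  by rewrite mem ltnn.
(* By [mem], [al] lists the columns of the diagram with rows [be]. *)
have cb k : capped k be = sumn (take k al).
  rewrite sumn_take /capped (big_nth 0%N) big_mkord sbe.
  under eq_bigr do rewrite -sum_ltn.
  rewrite exchange_big; apply: eq_bigr => i _ /=.
  under eq_bigr do rewrite -mem.
  rewrite sum_ltn; apply/minn_idPl; apply: leqW.
  by rewrite -tal; exact: nth_le_sumn.
apply: take_inj_sum => [|r]; first by rewrite sbe.
(* Totals agree, so the bound on columns says excess k mu <= excess k be; at k = nth 0 be r this is
   the missing comparison of partial sums. *)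
apply/eqP; rewrite eqn_leq ub2 /= -(excess_sorted r so).
apply: leq_trans (excess_ge (nth 0%N be r) r mu) _; rewrite leq_add2r.
have := capped_excess (nth 0%N be r) be; have := capped_excess (nth 0%N be r) mu.
have := ub1 (nth 0%N be r); rewrite -cb; lia.
Qed.

(** * Spectral separation *)

Definition macop c F : symfun := macD 0 F - c *: F.

Definition macprod (r : seq Qqt) F := foldl (fun G c => macop c G) F r.

Lemma macop_linear c : linear (macop c).
Proof.
move=> a F G; rewrite /macop linearP scalerDr scalerBr !scalerA [c * a]mulrC opprD.
by rewrite addrACA.
Qed.

HB.instance Definition _ c :=
  GRing.isLinear.Build Qqt symfun symfun _ (macop c) (macop_linear c).

Lemma macop_comm c c' F : macop c (macop c' F) = macop c' (macop c F).
Proof.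
have E x y : macop x (macop y F) =
    macD 0 (macD 0 F) - x *: macD 0 F - y *: macD 0 F + (x * y) *: F.
  rewrite /macop [macD 0 (_ - _)]linearB /= [macD 0 (_ *: _)]linearZ /=.
  by rewrite scalerBr scalerA opprB addrA addrAC [X in X + _]addrAC.
by rewrite !E [c * c']mulrC [X in X + _ = _]addrAC.
Qed.

Lemma macprod_macop r c F : macprod r (macop c F) = macop c (macprod r F).
Proof. by elim: r F => //= d r IH F; rewrite macop_comm IH. Qed.

(** Coprime annihilators: removing the factors of r one at a time leaves an F with eigenvalue c, on
    which the other product acts by the nonzero scalar prod (c - d). *)
Lemma macprod_disjoint r s F : {in r & s, forall c d, c != d} ->
  macprod r F = 0 -> macprod s F = 0 -> F = 0.
Proof.
elim: r F => [|c r IH] F //= dis hr hs.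
have e0 : macop c F = 0.
  apply: IH => // [d d' dr ds|]; last by rewrite macprod_macop hs linear0.
  by apply: dis; rewrite // inE dr orbT.
have {}dis : {in s, forall d, c != d} by move=> d; apply: dis; rewrite mem_head.
have e : forall d, macop d F = (c - d) *: F.
  move=> d; move/eqP: e0; rewrite /macop subr_eq0 => /eqP ->.
  by rewrite scalerBl.
have es : forall s', macprod s' F = \prod_(d <- s') (c - d) *: F.
  move=> s'; rewrite /macprod; elim/last_ind: s' => [|s' d IHs] /=.
    by rewrite big_nil scale1r.
  by rewrite foldl_rcons IHs linearZ /= e scalerA big_rcons.
move/eqP: hs; rewrite es scaler_eq0 => /orP[|/eqP //].
rewrite prodf_seq_eq0 => /hasP[d ds /=].
by rewrite subr_eq0 (negbTE (dis d ds)).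
Qed.

Definition is_word n (w : seq nat) := (size w == n.+1) && (sumn w == n).

(** A statistic that strictly increases along [raises 0], turning the partial order into an
    induction. *)
Definition rank (w : seq nat) := (\sum_(i < (size w).+1) sumn (take i w))%N.

Lemma raises_rank w w' : raises 0 w' w -> w' <> w -> (rank w < rank w')%N.
Proof.
move=> [sz _ part] ne; rewrite ltnNge; apply/negP; rewrite /rank sz => h; apply: ne.
have p i : (sumn (take i w) <= sumn (take i w'))%N by have := part i; rewrite addn0.
apply: take_inj_sum => // i; apply/eqP; rewrite eqn_leq p andbT.
wlog iw : i / (i < (size w).+1)%N => [H|].
  have [|wi] := ltnP i (size w).+1; first exact: H.
  have := H (size w) (ltnSn _); rewrite take_size -sz take_size.
  by rewrite !take_oversize ?sz // ltnW.
rewrite leqNgt; apply/negP => lt.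
move: h; rewrite leqNgt => /negP; apply.
rewrite (bigD1 (Ordinal iw)) //= [X in (_ < X)%N](bigD1 (Ordinal iw)) //=.
by rewrite -addSn leq_add // leq_sum.
Qed.

Lemma word_macop bs ks c F :
  word bs ks (macop c F) = word bs ks (macD 0 F) - c * word bs ks F.
Proof. by rewrite /macop linearB linearZ. Qed.

Lemma macop_up_closed b n (U : pred (seq nat)) F c :
  (forall w w', is_word n w -> is_word n w' -> U w -> raises 0 w' w -> U w') ->
  (forall w, is_word n w -> U w -> word (nseq n.+1 b) w F = 0) ->
  forall w, is_word n w -> U w -> word (nseq n.+1 b) w (macop c F) = 0.
Proof.
move=> up kU w ww Uw; rewrite word_macop.
have /andP[/eqP sw tw] := ww.
rewrite word_macD ?size_nseq // => [|w' d _]; first by rewrite kU ?mulr0 ?mul0rn ?subr0.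
have ww' : is_word n w'.
  have [sz tot _] := d; rewrite /is_word sz sw eqxx /=.
  by move: tw; rewrite tot addn0.
by apply: kU => //; exact: up d.
Qed.

(* Remove maximal words one at a time: if [w] is maximal outside [U], then [macop (wordev w) F] also vanishes on [w]. *)
Lemma kill b n (U : pred (seq nat)) F :
  (forall w w', is_word n w -> is_word n w' -> U w -> raises 0 w' w -> U w') ->
  homogeneous n F ->
  (forall w, is_word n w -> U w -> word (nseq n.+1 b) w F = 0) ->
  exists2 r, macprod r F = 0 &
    {in r, forall c, exists w, [/\ is_word n w, ~~ U w & c = wordev (nseq n.+1 b) w]}.
Proof.
(* Exponents are at most n, so this finite type holds every word; it supplies maximal words and a
   count for the induction. *)
pose T := (n.+1).-tuple 'I_n.+1.
pose sw (x : T) : seq nat := [seq nat_of_ord i | i <- x].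
have swP w : is_word n w -> exists x, w = sw x.
  move=> /andP[sz /eqP e].
  have lt (i : nat) : (nth 0%N w i < n.+1)%N by rewrite ltnS -[X in (_ <= X)%N]e nth_le_sumn.
  exists [tuple Ordinal (lt i) | i < n.+1].
  apply: (@eq_from_nth _ 0%N) => [|i iw]; first by rewrite size_map size_tuple (eqP sz).
  rewrite (eqP sz) in iw.
  rewrite (nth_map ord0) ?size_tuple //.
  by rewrite -(tnth_nth ord0 _ (Ordinal iw)) tnth_mktuple.
pose P (V : pred (seq nat)) (x : T) := is_word n (sw x) && ~~ V (sw x).
move: {2}_.+1 (ltnSn #|P U|) => m; elim: m U F => // m IH U F lem up hF kU.
have [x0 Px0|noP] := pickP (P U); last first.
  exists [::] => //=; apply: (word_separates (b := b) hF) => w s e.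
  have ww : is_word n w by rewrite /is_word s e !eqxx.
  apply: kU => //; have [x ex] := swP w ww; have := noP x.
  by rewrite /P -ex ww /= => /negbFE.
case: (@arg_maxnP _ x0 (P U) (fun x => rank (sw x)) Px0) => x /andP[wx Ux] hmax.
pose w0 := sw x; pose c := wordev (nseq n.+1 b) w0.
pose U' w := U w || (w == w0).
have above w' : is_word n w' -> raises 0 w' w0 -> w' <> w0 -> U w'.
  move=> ww' d ne; apply/negPn/negP => nU.
  have [x' ex'] := swP _ ww'; have := hmax x'; rewrite /P -ex' ww' nU /= => /(_ isT).
  by rewrite leqNgt raises_rank.
have [] := IH U' (macop c F).
- rewrite ltnS in lem; apply: (leq_trans _ lem); apply: proper_card; apply/fintype.properP; split.
    apply/fintype.subsetP => y; rewrite !unfold_in /P /U' negb_or => /and3P[-> -> _] //.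
  by exists x; rewrite unfold_in /P ?wx //= /U' eqxx orbT.
- move=> w w' ww ww' /orP[Uw d|/eqP ew d].
    by rewrite /U' (up w) .
  rewrite /U' orbC; case: eqP => //= ne; apply: above => //.
  by rewrite -ew.
- by apply: homogeneousD; [exact: macD0_homogeneous|rewrite -scaleNr; exact: homogeneousZ].
- move=> w ww /orP[Uw|/eqP ->]; first exact: (macop_up_closed c up kU).
  rewrite word_macop word_macD.
  + by rewrite mulr1n subrr.
  + by rewrite size_nseq; case/andP: wx => /eqP.
  move=> w' d /(_ isT) ne.
  have ww' : is_word n w'.
    have [sz tot _] := d; move: wx; rewrite /is_word sz => /andP[-> /=].
    by rewrite -/w0 tot addn0.
  by apply: kU => //; exact: above.
move=> r r0 hr; exists (c :: r) => //= d; rewrite inE => /orP[/eqP ->|/hr].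
  by exists w0.
by case=> w [ww]; rewrite /U' negb_or => /andP[nU _] ->; exists w.
Qed.

(** * Modified Macdonald polynomials are eigenvectors *)

Lemma part_sorted (la : part) : sorted geq la.
Proof. by case: la => la /= /andP[]. Qed.

Lemma sorted_conj (mu : seq nat) : sorted geq (conj_part mu).
Proof.
rewrite /conj_part; apply: (homo_sorted (e := leq)); last exact: iota_sorted.
by move=> i j ij; apply: sub_count => x /=; exact: leq_ltn_trans.
Qed.

Lemma count_take_sorted i (s : seq nat) k : sorted geq s ->
  (count (fun r => i < r) (take k s) = minn (count (fun r => i < r) s) k)%N.
Proof.
elim: s k => [|x s IH] [|k] so /=; rewrite ?minn0 ?min0n //.
rewrite (IH k (path_sorted so)); case: ltnP => ix; first by rewrite /=; lia.
suff -> : count (fun r => i < r)%N s = 0%N by rewrite !min0n.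
apply/eqP; rewrite -leqn0 leqNgt -has_count; apply/hasPn => y ys.
have := @sorted_geq_nth (x :: s) 0 (index y (x :: s)) so isT.
by rewrite nth_index ?inE ?ys ?orbT //= -leqNgt => h; exact: leq_trans h ix.
Qed.

Lemma capped_conj (mu : seq nat) k : sorted geq mu ->
  capped k (conj_part mu) = sumn (take k mu).
Proof.
move=> so; rewrite /capped /conj_part big_map sumnE.
under eq_bigr do rewrite -count_take_sorted // -sum1_count big_mkcond /=.
rewrite exchange_big /= big_seq [RHS]big_seq; apply: eq_bigr => x xk.
rewrite -[head 0%N mu]subn0 -/(index_iota 0 (head 0%N mu)) big_mkord.
rewrite (eq_bigr (fun i : 'I_(head 0%N mu) => (i < x) : nat)%N); last first.
  by move=> i _; case: ltnP.
rewrite sum_ltn; apply/minn_idPl; rewrite -nth0.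
have xm := mem_take xk; rewrite -[x in (x <= _)%N](nth_index 0%N xm).
exact: sorted_geq_nth.
Qed.

Lemma homogeneous_schur (la : seq nat) : homogeneous (sumn la) (schur la).
Proof.
apply: homogeneous_sum => s _; rewrite mulr_sign -(@scaler_sign Qqt).
apply: homogeneousZ.
have [h|] := boolP [forall i : 'I_(size la), i <= nth 0 la i + s i]%N.
  have {}h i := forallP h i; rewrite -(jt_size h).
  by apply: homogeneous_prod => i; rewrite !mxE h; exact: homogeneous_complete.
rewrite negb_forall => /existsP[i hi]; rewrite (bigD1 i) //= !mxE (negbTE hi).
by rewrite mul0r; exact: homogeneous0.
Qed.

Lemma pleth_x1m_scalep u F : pleth_x1m u F = scalep (fun k => 1 - u ^+ k) F.
Proof. by rewrite /pleth_x1m plethysmE. Qed.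

Section Eigen.
Variables (H : part -> symfun) (HH : is_modified_macdonald H).

(** Dominance fixes the size of every la in the span, and X -> X(1-q) is invertible because 1 - q^k
    is nonzero for k > 0. *)
Lemma macdonald_homogeneous (mu : part) : homogeneous (sumn mu) (H mu).
Proof.
have [c cP e] := mac_q HH mu.
have c0 k : (0 < k)%N -> 1 - q ^+ k != 0.
  by move=> k0; rewrite subr_eq0 eq_sym (@par_exp_neq1 true).
rewrite -[H mu](scalepK c0) -pleth_x1m_scalep e; apply: scalep_homogeneous.
rewrite /lincomb big_seq; apply: homogeneous_sum => la /cP [<- _].
by apply: homogeneousZ; exact: homogeneous_schur.
Qed.

Lemma part_size_le (mu : part) : (size mu <= sumn mu)%N.
Proof.
have := @part_pos mu; elim: (mu : seq nat) => //= x s IH h.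
have : (0 < x)%N by apply: h; rewrite mem_head.
have : (size s <= sumn s)%N by apply: IH => k ks; apply: h; rewrite inE ks orbT.
lia.
Qed.

Lemma macdonald_eigen (mu : part) : macD 0 (H mu) = shapeev (cells mu) *: H mu.
Proof.
(* Here [mu'] is mu padded with zeros to the n + 1 letters of [word_separates], not the
   conjugate. *)
set n := sumn mu; pose r := (n.+1 - size mu)%N; pose mu' := mu ++ nseq r 0%N.
have rE : (size mu + r = n.+1)%N by rewrite subnKC // leqW // part_size_le.
have smu' : size mu' = n.+1 by rewrite size_cat size_nseq.
have tmu' : sumn mu' = n by rewrite sumn_cat sumn_nseq mul0n addn0.
have wmu' : is_word n mu' by rewrite /is_word smu' tmu' !eqxx.
have hF := macdonald_homogeneous mu.
pose c := wordev (nseq n.+1 false) mu'.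
have cE : c = shapeev (cells mu).
  by rewrite /c wordev_cells ?size_nseq // -rE cells_pad.
(* Applying the factor with root c beforehand makes v vanish at the word [mu'] too; [UB'] records
   this, and the only possible common root is gone. *)
pose v := macop c (H mu).
suff : v = 0 by rewrite /v /macop cE => /eqP; rewrite subr_eq0 => /eqP.
have hv : homogeneous n v.
  apply: homogeneousD; first exact: macD0_homogeneous.
  by rewrite -scaleNr; exact: homogeneousZ.
pose UA w := `[< exists k, (capped k mu < sumn (take k w))%N >].
pose UB w := `[< exists k, (sumn (take k mu') < sumn (take k w))%N >].
have upA w w' : is_word n w -> is_word n w' -> UA w -> raises 0 w' w -> UA w'.
  move=> _ _ /asboolP[k hk] [_ _ part]; apply/asboolP; exists k.
  by have := part k; rewrite addn0; exact: leq_trans.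
have upB w w' : is_word n w -> is_word n w' -> UB w -> raises 0 w' w -> UB w'.
  move=> _ _ /asboolP[k hk] [_ _ part]; apply/asboolP; exists k.
  by have := part k; rewrite addn0; exact: leq_trans.
have aboveB w : raises 0 w mu' -> w <> mu' -> UB w.
  move=> [sz _ part] ne; apply/asboolP; apply: contrapT => no; apply: ne.
  apply: take_inj_sum => // k; apply/eqP; rewrite eqn_leq.
  have := part k; rewrite addn0 => ->; rewrite andbT leqNgt.
  by apply/negP => h; apply: no; exists k.
have tak k : sumn (take k mu') = sumn (take k mu).
  rewrite !sumn_take; apply: eq_bigr => i _; rewrite nth_cat; case: ltnP => // h.
  by rewrite nth_nseq if_same nth_default.
have cap k : capped k mu' = capped k mu.
  by rewrite /capped big_cat /= [X in (_ + X)%N]big1_seq ?addn0 // => x /andP[_ /nseqP[-> _]]; rewrite min0n.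
have vA w : is_word n w -> UA w -> word (nseq n.+1 true) w v = 0.
  apply: (macop_up_closed _ upA) => {}w /andP[/eqP sw _] /asboolP[k hk].
  exact: (@word_capped true _ _ _ _ _ sw (part_sorted mu) (mac_q HH mu) hk).
have FB w : is_word n w -> UB w -> word (nseq n.+1 false) w (H mu) = 0.
  move=> /andP[/eqP sw _] /asboolP[k hk].
  apply: (@word_capped false _ _ _ _ k sw (sorted_conj mu) (mac_t HH mu)).
  by rewrite capped_conj ?part_sorted // -tak.
pose UB' w := UB w || (w == mu').
have vB w : is_word n w -> UB' w -> word (nseq n.+1 false) w v = 0.
  move=> ww /orP[Uw|/eqP ->]; first exact: (macop_up_closed c upB FB).
  rewrite word_macop word_macD ?size_nseq ?smu' //; first by rewrite mulr1n subrr.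
  move=> w' d /(_ isT) ne; apply: FB; last exact: aboveB.
  have [sz tot _] := d; rewrite /is_word sz smu' eqxx /=.
  by move: tot; rewrite tmu' addn0 => <-.
have upB' w w' : is_word n w -> is_word n w' -> UB' w -> raises 0 w' w -> UB' w'.
  move=> ww ww' /orP[Uw d|/eqP -> d]; rewrite /UB'; first by rewrite (upB w).
  by rewrite orbC; case: eqP => //= ne; exact: aboveB.
have [r1 e1 h1] := kill upA hv vA; have [r2 e2 h2] := kill upB' hv vB.
apply: (macprod_disjoint _ e1 e2) => x y /h1[al [wal nal ->]] /h2[be [wbe nbe ->]].
apply/eqP => e; move: nbe; rewrite /UB' negb_or => /andP[nbe /eqP]; apply.
have /andP[/eqP sal /eqP tal] := wal; have /andP[/eqP sbe /eqP tbe] := wbe.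
apply: (shape_eq sal sbe tal tbe tmu' smu' _ _ e) => k; rewrite leqNgt; apply/negP => lt.
  by case/negP: nal; apply/asboolP; exists k; rewrite -cap.
by case/negP: nbe; apply/asboolP; exists k.
Qed.

End Eigen.

(** * Evaluation at 1 - u *)

Lemma eq_plift (R : comNzRingType) (iota : {rmorphism Qqt -> R}) (a b : nat -> R) :
  (forall k, (0 < k)%N -> a k = b k) -> plift iota a =1 plift iota b.
Proof.
move=> ab; apply: sfmorph_eq => [c|k k0] /=; first by rewrite !plift_alg.
by rewrite !plift_psum ?ab.
Qed.

Fixpoint alphabet (bs : seq bool) (xs : seq Qqt) (k : nat) : Qqt :=
  match bs, xs with
  | b :: bs', x :: xs' => - ((1 - par b ^+ k) * x ^+ k) + alphabet bs' xs' k
  | _, _ => 0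
  end.

Lemma plift_removal u x a F :
  plift idfun (fun k => - ((1 - u ^+ k) * x ^+ k) + a k) F =
  plift idfun a (removal u F).[x%:A].
Proof.
pose f := [the {rmorphism _ -> _} of
  plift idfun a \o horner_eval (x%:A : symfun) \o removal u].
apply: (@sfmorph_eq _ (plift idfun _) f) => [c|k k0] /=.
  by rewrite removal_alg /horner_eval hornerC !plift_alg.
rewrite removal_psum // /horner_eval !hornerE plift_psum // rmorphB rmorphM.
rewrite /= plift_psum // plift_alg addrC; congr (_ - _ * _).
by rewrite exprZn expr1n plift_alg.
Qed.

Lemma word_alphabet bs xs F : size xs = size bs ->
  (forall ks, size ks = size bs -> word bs ks F = 0) ->
  plift idfun (alphabet bs xs) F = 0.
Proof.
elim: bs xs F => [|b bs IH] [|x xs] F //=; first by move=> _ /(_ [::] erefl).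
move=> [sz] h; rewrite plift_removal horner_coef rmorph_sum /= big1 // => k _.
rewrite exprZn expr1n mulr_algr pliftZ /= IH ?mulr0 // => ks sk.
by apply: (h ((k : nat) :: ks)); rewrite /= sk.
Qed.

(* Chosen so that the alphabet telescopes, see [alphabet_points]. *)
Fixpoint points z (bs : seq bool) : seq Qqt :=
  if bs is b :: bs' then (z / par b) :: points (z / par b) bs' else [::].

Lemma size_points z bs : size (points z bs) = size bs.
Proof. by elim: bs z => //= b bs IH z; rewrite IH. Qed.

Lemma alphabet_points z bs k :
  alphabet bs (points z bs) k = z ^+ k - (z / \prod_(b <- bs) par b) ^+ k.
Proof.
elim: bs z => [|b bs IH] z /=; first by rewrite big_nil divr1 subrr.
rewrite IH big_cons invfM mulrA mulrBl mul1r -exprMn mulrCA divff ?par_neq0 // mulr1.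
by rewrite opprB addrA subrK.
Qed.

Lemma mem_wcells_hook i j a b a0 b0 ks :
  (i, j) \in wcells a0 b0 (nseq a true ++ nseq b false) ks ->
  (i < a0 + a)%N || (j < b0 + b)%N.
Proof.
have rows : forall a1 b1 ks1, (i, j) \in wcells a1 b1 (nseq b false) ks1 -> (j < b1 + b)%N.
  elim: b => [|b' IH] a1 b1 [|k ks1] //=.
  rewrite mem_cat addnS => /orP[/mapP[i' _ [_ ->]]|/IH].
    by rewrite ltnS leq_addr.
  by rewrite addSn.
elim: a a0 ks => [|a IH] a0 ks /=; first by move/rows ->; rewrite orbT.
case: ks => [|k ks] //=.
rewrite mem_cat addnS => /orP[/mapP[j' _ [-> _]]|/IH]; first by rewrite ltnS leq_addr.
by rewrite addSn.
Qed.

Lemma rank_le w : (rank w <= (size w).+1 * sumn w)%N.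
Proof.
rewrite /rank -[X in (_ <= X * _)%N]card_ord -sum_nat_const; apply: leq_sum => i _.
by rewrite -[X in (_ <= sumn X)%N](cat_take_drop i w) sumn_cat leq_addr.
Qed.

(* Descending induction on the rank: [word_macD] forces an eigenvector to vanish as soon as no diagonal entry equals its eigenvalue. *)
Lemma word_eigen_eq0 bs c F : macD 0 F = c *: F ->
  (forall ks, size ks = size bs -> wordev bs ks != c) ->
  forall ks, size ks = size bs -> word bs ks F = 0.
Proof.
move=> eF ne ks; move: {2}_.+1 (ltnSn ((size ks).+1 * sumn ks - rank ks)) => m.
elim: m ks => // m IH ks lem sks.
have : word bs ks (macD 0 F) = wordev bs ks * word bs ks F.
  rewrite word_macD // => ks' d /(_ isT) dif; have [sz tot _] := d.
  apply: IH; last by rewrite sz.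
  have := raises_rank d dif; have := rank_le ks'.
  by rewrite sz; move: lem; rewrite tot addn0; lia.
rewrite eF linearZ /= => /eqP; rewrite -subr_eq0 -mulrBl mulf_eq0 subr_eq0 eq_sym.
by rewrite (negbTE (ne ks sks)) => /eqP.
Qed.

Section Evaluation.
Variables (H : part -> symfun) (HH : is_modified_macdonald H).

Lemma macdonald_vanishing (mu : part) c : c \in cells mu ->
  plift idfun (fun k => 1 - (weight c)^-1 ^+ k) (H mu) = 0.
Proof.
case: c => a b ab; pose bs := nseq a true ++ nseq b false.
rewrite (@eq_plift _ _ _ (alphabet bs (points 1 bs))) => [|k _].
  apply: word_alphabet; first exact: size_points.
  apply: (word_eigen_eq0 (macdonald_eigen HH mu)) => ks sks.
  rewrite wordev_cells //; apply/eqP => /shapeev_inj/perm_mem/(_ (a, b)).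
  by rewrite ab => /mem_wcells_hook; rewrite !add0n !ltnn.
by rewrite alphabet_points expr1n mul1r big_cat /= !big_nseq !iter_mulr_1.
Qed.

(** * F[1-u] as a polynomial in u *)

Definition macpoly (F : symfun) : {poly Qqt} := plift polyC (fun k => 1 - 'X^k) F.

Lemma horner_macpoly F u :
  (macpoly F).[u] = plift idfun (fun k => 1 - u ^+ k) F.
Proof.
apply: (@sfmorph_eq _ (horner_eval u \o plift polyC (fun k => 1 - 'X^k)) (plift idfun _)).
  by move=> c /=; rewrite !plift_alg /horner_eval hornerC.
by move=> k k0 /=; rewrite !plift_psum // /horner_eval !hornerE.
Qed.

Lemma size_macpoly n F : homogeneous n F -> (size (macpoly F) <= n.+1)%N.
Proof.
elim/homogeneous_ind => [|a {}F G IH1 IH2|la <-].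
- by rewrite /macpoly rmorph0 size_poly0.
- rewrite /macpoly plift_linear (leq_trans (size_polyD _ _)) // geq_max IH2 andbT.
  rewrite mul_polyC; apply: leq_trans (size_scale_leq _ _) _; exact: IH1.
rewrite /macpoly plift_psum_part.
elim: (la : seq nat) => [|k s IH]; first by rewrite big_nil size_poly1.
rewrite big_cons /= (leq_trans (size_polyMleq _ _)) //.
have h : (size (1 - 'X^k : {poly Qqt})%R <= k.+1)%N.
  rewrite (leq_trans (size_polyD _ _)) // geq_max size_poly1 size_polyN size_polyXn.
  by rewrite leqnn.
by move: (leq_add h IH); rewrite addSn addnS; case: (_ + _)%N.
Qed.

Definition shapepoly (s : seq (nat * nat)) : {poly Qqt} :=
  \prod_(c <- s) (1 - (weight c) *: 'X).

Lemma size_shapepoly s : (size (shapepoly s) <= (size s).+1)%N.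
Proof.
elim: s => [|c s IH]; first by rewrite /shapepoly big_nil size_poly1.
rewrite /shapepoly big_cons (leq_trans (size_polyMleq _ _)) //=.
have h : (size (1 - weight c *: 'X : {poly Qqt})%R <= 2)%N.
  rewrite (leq_trans (size_polyD _ _)) // geq_max size_poly1 size_polyN /=.
  by rewrite (leq_trans (size_scale_leq _ _)) // size_polyX.
by move: (leq_add h IH); rewrite /shapepoly; case: (_ + _)%N.
Qed.

Lemma horner_shapepoly s u : (shapepoly s).[u] = \prod_(c <- s) (1 - weight c * u).
Proof.
by rewrite /shapepoly horner_prod; apply: eq_bigr => c _; rewrite !hornerE.
Qed.

Lemma cells_uniq mu : uniq (cells mu).
Proof.
rewrite /cells; apply: allpairs_uniq_dep => [|j _|]; rewrite ?iota_uniq //.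
by move=> [j i] [j' i'] _ _ /= [-> ->].
Qed.

Lemma size_cells mu : size (cells mu) = sumn mu.
Proof.
rewrite size_allpairs_dep; congr sumn.
by apply: (@eq_from_nth _ 0%N) => [|i]; rewrite size_map size_iota // => il;
  rewrite (nth_map 0%N) ?size_iota // nth_iota.
Qed.

Lemma macdonald_macpoly (mu : part) : plift idfun (fun _ => 1) (H mu) = 1 ->
  macpoly (H mu) = shapepoly (cells mu).
Proof.
move=> H1; apply/eqP; rewrite -subr_eq0; apply/eqP.
(* Both polynomials are 1 at 0, so their difference has the root 0 besides the n roots from the
   cells: n + 1 distinct roots against degree at most n. *)
apply: (@roots_geq_poly_eq0 _ _ (0 :: [seq (weight c)^-1 | c <- cells mu])).
- apply/allP => x; rewrite inE rootE !hornerE => /orP[/eqP ->|/mapP[c cmu ->]].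
    rewrite horner_macpoly horner_shapepoly big1 => [|c _]; last by rewrite mulr0 subr0.
    rewrite (@eq_plift _ _ _ (fun _ => 1)) ?H1 ?subrr // => k k0.
    by rewrite expr0n gtn_eqF // subr0.
  rewrite horner_macpoly macdonald_vanishing // horner_shapepoly (big_rem c) //=.
  by rewrite divff ?weight_neq0 // subrr mul0r subrr.
- rewrite /= map_inj_uniq ?cells_uniq ?andbT; last by move=> c c' /invr_inj/weight_inj.
  by apply/mapP => -[c _ /esym/eqP]; rewrite invr_eq0 (negbTE (weight_neq0 c)).
rewrite /= size_map size_cells (leq_trans (size_polyD _ _)) // geq_max size_polyN.
rewrite (size_macpoly (macdonald_homogeneous HH mu)) /=.
by rewrite (leq_trans (size_shapepoly _)) // size_cells.
Qed.
End Evaluation.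

(** * The Hall product *)

(** Over a fixed range, adding a part changes a single factor. *)
Lemma zee_wide (s : seq nat) N : {in s, forall k, (k < N)%N} ->
  zee s = (\prod_(i < N) (i ^ count_mem (i : nat) s * (count_mem (i : nat) s)`!))%N.
Proof.
move=> h; pose f i := (i ^ count_mem i s * (count_mem i s)`!)%N.
rewrite -(big_mkord xpredT f) /index_iota subn0 (bigID (mem s)) /= [X in (_ * X)%N]big1.
  rewrite muln1 -big_filter /zee; apply: perm_big; apply: uniq_perm.
  - exact: undup_uniq.
  - by rewrite filter_uniq ?iota_uniq.
  move=> i; rewrite mem_undup mem_filter mem_iota /= add0n.
  by case E : (i \in s) => //=; rewrite h.
move=> i /count_memPn e; rewrite /f e fact0.
by rewrite expn0.
Qed.

Lemma zee_perm (s s' : seq nat) : perm_eq s s' -> zee s = zee s'.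
Proof.
move=> p; pose N := (\sum_(k <- s) k).+1.
have h : {in s, forall k, (k < N)%N}.
  by move=> k ks; rewrite ltnS (big_rem k) //= leq_addr.
rewrite (zee_wide h) (zee_wide (N := N)); last by move=> k; rewrite -(perm_mem p); exact: h.
by apply: eq_bigr => i _; rewrite (seq.permP p).
Qed.

Lemma zee_cons k s : zee (k :: s) = (k * (count_mem k s).+1 * zee s)%N.
Proof.
pose N := (\sum_(i <- k :: s) i).+1.
have h : {in k :: s, forall i, (i < N)%N}.
  by move=> i ks; rewrite ltnS (big_rem i) //= leq_addr.
have kN : (k < N)%N by apply: h; rewrite mem_head.
rewrite (zee_wide h) (zee_wide (N := N)) => [|i is_]; last by apply: h; rewrite inE is_ orbT.
rewrite (bigD1 (Ordinal kN)) //= [X in _ = (_ * X)%N](bigD1 (Ordinal kN)) //= eqxx add1n expnS factS.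
rewrite (eq_bigr (fun i : 'I_N => i ^ count_mem (i : nat) s * (count_mem (i : nat) s)`!)%N).
  by rewrite mulnACA -!mulnA.
by move=> i ne; rewrite eq_sym -val_eqE /= in ne; rewrite (negbTE ne) add0n.
Qed.

Lemma hall_linearr F : scalar (hall F).
Proof.
move=> a G G'; rewrite /hall mulr_sumr -big_split /=; apply: eq_bigr => la _.
by rewrite (coords_linear psum_part_basis); ring.
Qed.

HB.instance Definition _ F :=
  GRing.isLinear.Build Qqt symfun Qqt *%R (hall F) (hall_linearr F).

Lemma hallE F G (S : {fset part}) : (finsupp (pcoords F) `<=` S)%fset ->
  hall F G = \sum_(la <- S) pcoords F la * pcoords G la * (zee la)%:R.
Proof.
move=> sub; rewrite /hall; apply: big_fset_incl => // la _ h.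
by rewrite (fsfun_dflt h) !mul0r.
Qed.

Lemma hallC F G : hall F G = hall G F.
Proof.
pose S := (finsupp (pcoords F) `|` finsupp (pcoords G))%fset.
rewrite !(@hallE _ _ S) ?fsubsetUl ?fsubsetUr //.
by apply: eq_bigr => la _; rewrite [pcoords G _ * _]mulrC.
Qed.

Lemma hall_psum_part F la : hall F (psum_part la) = pcoords F la * (zee la)%:R.
Proof.
rewrite hallC (@hallE _ _ [fset la]%fset).
  by rewrite big_seq_fset1 (coords_base psum_part_basis) eqxx mul1r.
apply/fsubsetP => mu; rewrite mem_finsupp (coords_base psum_part_basis) inE.
by case: (mu == la); rewrite ?eqxx.
Qed.

Lemma mkpart_rem (la : part) k : k \in (la : seq nat) -> la = mkpart (k :: rem k la).
Proof.
move=> kla; apply: part_eqP; rewrite perm_sym.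
have p := perm_to_rem kla; rewrite perm_sym in p.
apply: perm_trans p; apply: perm_trans (mkpart_perm _) _.
rewrite (_ : [seq _ <- _ | _] = k :: rem k la) //; apply/all_filterP/allP => i.
by rewrite -(perm_mem (perm_to_rem kla)); exact: part_pos.
Qed.

(** Multiplication by p_k is adjoint to k d/dp_k. *)
Lemma hall_psum_mul k G la : (0 < k)%N ->
  hall (psum k * G) (psum_part la) =
  if k \in (la : seq nat)
  then (k * count_mem k la)%:R * hall G (psum_part (mkpart (rem k la))) else 0.
Proof.
move=> k0; rewrite [hall (_ * _) _]hallC [hall G _]hallC.
elim/(basis_ind psum_part_basis): G => [|a G G' IH IH'|mu].
- by rewrite mulr0 !linear0 mulr0 if_same.
- rewrite mulrDr -scalerAr !linearP /= IH IH'.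
  by case: ifP => _; rewrite ?mulr0 ?addr0 // mulrDr; congr (_ + _); rewrite mulrCA.
have -> : psum k * psum_part mu = psum_part (mkpart (k :: mu)).
  rewrite /psum_part prod_mkpart ?big_cons // => i; rewrite inE => /orP[/eqP -> //|].
  exact: part_pos.
rewrite !hall_psum_part !(coords_base psum_part_basis).
have kmu : perm_eq (mkpart (k :: mu)) (k :: mu).
  apply: perm_trans (mkpart_perm _) _; rewrite (_ : [seq _ <- _ | _] = k :: mu) //.
  apply/all_filterP/allP => i; rewrite inE => /orP[/eqP -> //|]; exact: part_pos.
case: ifP => [kla|/negbT kla]; last first.
  case: eqP => [e|_]; rewrite ?mul0r //.
  by case/negP: kla; rewrite -e (perm_mem kmu) mem_head.
have prem : perm_eq (mkpart (rem k la)) (rem k la).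
  apply: perm_trans (mkpart_perm _) _; rewrite (_ : [seq _ <- _ | _] = rem k la) //.
  by apply/all_filterP/allP => i /mem_rem; exact: part_pos.
have -> : (mkpart (k :: mu) == la) = (mu == mkpart (rem k la)).
  apply/eqP/eqP => e.
    apply: part_eqP; rewrite perm_sym; apply: perm_trans prem _.
    rewrite -(perm_cons k); apply: perm_trans kmu; rewrite e perm_sym.
    exact: (perm_to_rem kla).
  rewrite [RHS](mkpart_rem kla); apply: part_eqP; apply: perm_trans kmu _.
  rewrite e; apply: (perm_trans (y := k :: rem k la)); first by rewrite perm_cons.
  by rewrite -(mkpart_rem kla) perm_sym; exact: (perm_to_rem kla).
case: eqP => [e|_]; rewrite ?mul0r ?mulr0 // !mul1r -natrM; congr (_%:R).
rewrite (zee_perm kmu) zee_cons; congr (_ * _ * _)%N.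
by rewrite (seq.permP (perm_to_rem kla)) /= eqxx e (seq.permP prem).
Qed.

Lemma sum_count_mem (s : seq nat) n : {in s, forall k, 0 < k < n}%N ->
  (\sum_(1 <= k < n) k * count_mem k s = sumn s)%N.
Proof.
elim: s => [|x s IH] h; first by rewrite big1 // => k _; rewrite muln0.
have /andP[x0 xn] := h x (mem_head _ _).
rewrite /= -IH => [|k ks]; last by apply: h; rewrite inE ks orbT.
under eq_bigr do rewrite mulnDr.
rewrite big_split /=; congr (_ + _)%N.
rewrite (bigD1_seq x) ?iota_uniq //=; last by rewrite mem_index_iota x0.
rewrite eqxx muln1 big1 ?addn0 // => k; rewrite eq_sym => /negbTE ->.
by rewrite muln0.
Qed.

(** The reproducing property of the Cauchy kernel: x_n is h_n[XA] with p_k[A] = al k. In Newton's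
    recursion, adjointness makes p_k contribute k m_k(la) times the product, and these
    multiplicities add up to n. *)
Lemma newton_hall (al : nat -> Qqt) (x : nat -> symfun) :
  newton (fun k => - (al k *: psum k)) x ->
  forall (la : part), hall (x (sumn la)) (psum_part la) = \prod_(k <- la) al k.
Proof.
move=> [x0 xS] la; move: {2}(sumn la) (erefl (sumn la)) => n; elim/ltn_ind: n la => n IH la e.
have pos k : k \in (la : seq nat) -> (0 < k < n.+1)%N.
  by move=> kla; rewrite (part_pos kla) ltnS -e (perm_sumn (perm_to_rem kla)) leq_addr.
have [n0|npos] := posnP n.
  have -> : la = mkpart [::].
    apply: part_eqP; case: la {e} pos => -[|k s] P //= pos.
    by have := pos k (mem_head _ _); rewrite n0; case: k {pos P}.
  rewrite /= x0 hall_psum_part (_ : 1 = psum_part (mkpart [::])).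
    by rewrite (coords_base psum_part_basis) eqxx mul1r big_nil /zee big_nil.
  by rewrite /psum_part big_nil.
have nK (y : Qqt) : y *+ n = (\prod_(k <- la) al k) *+ n -> y = \prod_(k <- la) al k.
  move=> /eqP; rewrite -subr_eq0 -mulrnBl => /eqP h; apply/eqP; rewrite -subr_eq0.
  by apply/eqP; apply: (@torsion_free_Qqt _ n.-1); rewrite prednK.
apply: nK; rewrite e hallC -raddfMn /= xS linearN /= [hall _ (bigop.body _ _ _)]linear_sum -sumrN.
transitivity (\sum_(1 <= k < n.+1) (\prod_(k <- la) al k) *+ (k * count_mem k la)).
  apply: eq_big_nat => k /andP[k0 kn].
  rewrite /= mulNr linearN opprK -scalerAl linearZ /= hallC hall_psum_mul //.
  case: ifP => [kla|/negbT/count_memPn ->]; last by rewrite mulr0 muln0 mulr0n.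
  have en : (n - k)%N = sumn (mkpart (rem k la)).
    rewrite -e (perm_sumn (perm_to_rem kla)) /= addKn; apply: perm_sumn.
    rewrite perm_sym; apply: perm_trans (mkpart_perm _) _.
    rewrite (_ : [seq _ <- _ | _] = rem k la) //.
    by apply/all_filterP/allP => i /mem_rem; exact: part_pos.
  have lt : (n - k < n)%N by rewrite ltn_subrL k0.
  rewrite en (IH _ lt _ (esym en)).
  rewrite mulrCA mulr_natl; congr (_ *+ _).
  rewrite prod_mkpart => [|i /mem_rem]; last exact: part_pos.
  by rewrite (perm_big _ (perm_to_rem kla)) big_cons.
by rewrite sumrMnr sum_count_mem // e.
Qed.

Lemma hall_complete n F : homogeneous n F -> hall F (complete n) = plift idfun (fun _ => 1) F.
Proof.
have nw : newton (fun k => - ((1 : Qqt) *: psum k)) complete.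
  by apply: eq_newton newton_complete => // k _; rewrite scale1r.
rewrite hallC; elim/homogeneous_ind => [|a {}F G IH1 IH2|la <-].
- by rewrite raddf0 rmorph0.
- by rewrite linearP /= IH1 IH2 plift_linear.
by rewrite (newton_hall nw) plift_psum_part.
Qed.

(** The left side pairs F with h_n[X(1-u)], whose series is the product of the series of (-u)^k e_k
    and of h_k; then [newton_hall] applies with A = 1 - u. *)
Lemma hall_elem_complete n F u : homogeneous n F ->
  \sum_(k < n.+1) hall (elem k * complete (n - k)) F * (- u) ^+ k = (macpoly F).[u].
Proof.
pose x := conv (fun k => u%:A ^+ k * eps k) complete.
have nw : newton (fun k => - ((1 - u ^+ k) *: psum k)) x.
  have h := newton_conv (newton_sign u%:A newton_eps) newton_complete.
  apply: eq_newton h => // k _.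
  by rewrite exprZn expr1n mulr_algl scalerBl scale1r opprB.
have xE : x n = \sum_(k < n.+1) (- u) ^+ k *: (elem k * complete (n - k)).
  apply: eq_bigr => k _; rewrite exprZn expr1n mulr_algl /eps scalerA -exprMn mulrN1.
  by rewrite scalerAl.
move=> hF; rewrite horner_macpoly.
transitivity (hall (x n) F).
  rewrite xE hallC linear_sum; apply: eq_bigr => k _.
  by rewrite linearZ /= hallC mulrC.
elim/homogeneous_ind: hF => [|a {}F G IH1 IH2|la <-].
- by rewrite raddf0 rmorph0.
- by rewrite linearP /= IH1 IH2 plift_linear.
by rewrite (newton_hall nw) plift_psum_part.
Qed.

(** Every factor 1 - u^k of p_la[1-u] vanishes at u = 1, so two parts kill the derivative; the
    single part n gives -n, and z_(n) = n. *)
Lemma hall_psum n F : (0 < n)%N -> homogeneous n F ->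
  hall (psum n) F = - (macpoly F)^`().[1].
Proof.
move=> n0; elim/homogeneous_ind => [|a {}F G IH1 IH2|la e].
- by rewrite raddf0 /macpoly rmorph0 deriv0 horner0 oppr0.
- have -> : macpoly (a *: F + G) = a *: macpoly F + macpoly G.
    by rewrite /macpoly plift_linear mul_polyC.
  by rewrite linearP /= IH1 IH2 derivD derivZ hornerD hornerZ opprD mulrN.
have -> : macpoly (psum_part la) = \prod_(k <- la) (1 - 'X^k).
  by rewrite /macpoly plift_psum_part.
have root k : (1 - 'X^k : {poly Qqt}).[1] = 0.
  by rewrite hornerD hornerN hornerXn hornerC expr1n subrr.
case: la e => -[|k [|j s]] P /= e; first by rewrite -e in n0.
  rewrite addn0 in e; subst k; rewrite big_seq1 derivB derivC sub0r derivXn hornerN.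
  rewrite hornerMn hornerXn expr1n opprK.
  have -> : psum n = psum_part (Part P) by rewrite /psum_part big_seq1.
  rewrite hall_psum_part (coords_base psum_part_basis) eqxx mul1r.
  by rewrite zee_cons /zee big_nil !muln1.
rewrite !big_cons derivM hornerD !hornerM !root !mul0r mulr0 add0r oppr0.
rewrite psum_mkpart // hall_psum_part.
rewrite (coords_base psum_part_basis); case: eqP => [/(congr1 (size \o part_val))|_]; last by rewrite mul0r.
by rewrite /= size_sort /= n0.
Qed.

(** * Conclusion *)

Lemma poly_horner_inj (p r : {poly Qqt}) : (forall u, p.[u] = r.[u]) -> p = r.
Proof.
move=> h; apply/eqP; rewrite -subr_eq0; apply/eqP.
apply: (@roots_geq_poly_eq0 _ _ [seq n%:R | n <- iota 0 (size (p - r)%R)]).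
- by apply/allP => x _; rewrite rootE hornerD hornerN h subrr.
- rewrite map_inj_uniq ?iota_uniq // => i j; wlog ij : i j / (i <= j)%N.
    by move=> H e; case/orP: (leq_total i j) => h'; [exact: H|exact/esym/H].
  move/esym/eqP; rewrite -subr_eq0 -natrB // nat_Qqt_eq0 subn_eq0 => ji.
  by apply/eqP; rewrite eqn_leq ij.
by rewrite size_map size_iota.
Qed.

Lemma newton_shapepoly s :
  newton (fun k => \sum_(c <- s) weight c ^+ k) (fun n => (shapepoly s)`_n).
Proof.
elim: s => [|c s IH].
  rewrite /shapepoly big_nil; split=> [|n]; rewrite !coef1 //.
  rewrite big1 => [|k _]; last by rewrite big_nil mul0r.
  by case: n => [|n]; rewrite ?mulr0n ?mul0rn oppr0.
apply: eq_newton (newton_conv IH (newton_lin (weight c))) => [k _|n].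
  by rewrite big_cons addrC.
rewrite conv_lin /shapepoly big_cons -/(shapepoly s) mulrBl mul1r coefB -scalerAl coefZ.
by rewrite coefXM; case: n => [|n] /=; rewrite ?mulr0 // mulrC.
Qed.

(** Both sides solve Newton's recursion for the power sums of the weights of the cells. *)
Lemma pleth_B_eps mu n : pleth_B mu (eps n) = (shapepoly (cells mu))`_n.
Proof.
rewrite /pleth_B plethysmE.
have nw := newton_map (plift (in_alg Qqt^o)
   (fun k => \sum_(c <- cells mu) (q ^+ c.1 * t ^+ c.2) ^+ k)) newton_eps.
apply: (newton_unique torsion_free_Qqt nw).
by apply: eq_newton (newton_shapepoly (cells mu)) => // k k0; rewrite /= plift_psum.
Qed.

Lemma deriv_shapepoly s : uniq s -> (0%N, 0%N) \in s ->
  (shapepoly s)^`().[1] = - \prod_(c <- s | c != (0%N, 0%N)) (1 - weight c).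
Proof.
move=> us s0; rewrite /shapepoly (bigD1_seq (0%N, 0%N)) //= derivM hornerD !hornerM.
rewrite weight00 scale1r.
have -> : (1 - 'X : {poly Qqt}).[1] = 0 by rewrite !hornerE subrr.
have -> : (1 - 'X : {poly Qqt})^`() = (-1)%:P by rewrite derivB derivX -polyC1 derivC sub0r polyCN.
rewrite hornerC mul0r addr0 mulN1r horner_prod; congr (- _).
by apply: eq_bigr => c _; rewrite !hornerE.
Qed.

Lemma schur_row n : schur [:: n] = complete n.
Proof. by rewrite /schur det_mx11 !mxE /= addn0 subn0. Qed.

Lemma cells_origin (mu : part) : (0 < sumn mu)%N -> (0%N, 0%N) \in cells mu.
Proof.
case: mu => -[|k s] P //= _; rewrite /cells /=.
have := @part_pos (Part P) k (mem_head _ _); case: k P => // k P _.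
Qed.

Section Final.
Variables (H : part -> symfun) (HH : is_modified_macdonald H).

Lemma macpoly_macdonald (mu : part) : macpoly (H mu) = shapepoly (cells mu).
Proof.
apply: (macdonald_macpoly HH); rewrite -(hall_complete (macdonald_homogeneous HH mu)).
by rewrite -schur_row (mac_1 HH).
Qed.

Lemma hall_psum_macdonald (mu : part) : (0 < sumn mu)%N ->
  hall (psum (sumn mu)) (H mu) =
  \prod_(c <- cells mu | c != (0%N, 0%N)) (1 - q ^+ c.1 * t ^+ c.2).
Proof.
move=> n0; rewrite (hall_psum n0 (macdonald_homogeneous HH mu)) macpoly_macdonald.
by rewrite deriv_shapepoly ?cells_uniq ?cells_origin // opprK.
Qed.

Lemma hall_elem_complete_macdonald (mu : part) k : (k <= sumn mu)%N ->
  hall (elem k * complete (sumn mu - k)) (H mu) = pleth_B mu (elem k).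
Proof.
set n := sumn mu => kn.
pose R := \poly_(j < n.+1) ((-1) ^+ j * hall (elem j * complete (n - j)) (H mu)).
have RE : R = shapepoly (cells mu).
  apply: poly_horner_inj => u; rewrite -macpoly_macdonald.
  rewrite -(hall_elem_complete u (macdonald_homogeneous HH mu)) horner_poly.
  apply: eq_bigr => j _; rewrite [(- u) ^+ j]exprNn.
  by rewrite mulrA; congr (_ * _); exact: mulrC.
have epsE : pleth_B mu (eps k) = (-1) ^+ k * pleth_B mu (elem k).
  rewrite /pleth_B !plethysmE /eps pliftZ; congr (_ * _); exact: mulr1.
have := pleth_B_eps mu k; rewrite epsE -RE coef_poly ltnS kn.
by move=> e; apply: (mulfI (_ : (-1) ^+ k != 0)); rewrite ?signr_eq0 //; exact: esym.
Qed.

Lemma macdonald_coords n F la : homogeneous n F -> la \in finsupp (coords H F) -> sumn la = n.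
Proof.
move=> hF; rewrite mem_finsupp; apply: (homogeneous_coords (mac_basis HH)) hF.
exact: macdonald_homogeneous.
Qed.

End Final.

Theorem proposition1p2 (H : part -> symfun) (HH : is_modified_macdonald H)
    (n : nat) (hn : (1 <= n)%N) (F : symfun) (hF : homogeneous n F) :
  nabla_star H (psum n) F = PiOp H F /\
  (forall k : nat, (k <= n)%N ->
     nabla_star H (elem k * complete (n - k)) F = Delta H (elem k) F).
Proof.
rewrite /nabla_star /PiOp /Delta /linext /lincomb.
(* Only partitions of n occur in the expansion of F, so the eigenvalues need to agree on these
   alone. *)
split=> [|k kn]; apply: eq_big_seq => la /(macdonald_coords HH hF) e; subst n.
  by rewrite hall_psum_macdonald.
by rewrite hall_elem_complete_macdonald.
Qed.
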